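(* There is a locally countable Borel partial order of height three with no Borel embedding into Turing reducibility.
   Context: A Borel partial order is a partial order $(P,\leq_P)$ with $P$ a Borel subset of $2^\omega$ and $\leq_P$ a Borel subset of $2^\omega\times 2^\omega$. It is locally countable if every element has at most countably many strict predecessors, and has height $n$ if its longest chain has length exactly $n$. A Borel embedding of $P$ into Turing reducibility is a Borel measurable function $f\colon P\to 2^\omega$ such that for all $x,y\in P$, $x\leq_P y \iff f(x)\leq_T f(y)$. *)

(* Defs.v *)
From Stdlib Require Import List Arith.
Import ListNotations.

Definition Cantor := nat -> bool.

Inductive sigma_gen {T : Type} (G : (T -> Prop) -> Prop) : (T -> Prop) -> Prop :=
| sg_gen A : G A -> sigma_gen G A
| sg_compl A : sigma_gen G A -> sigma_gen G (fun x => ~ A x)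
| sg_union (A : nat -> T -> Prop) :
    (forall n, sigma_gen G (A n)) -> sigma_gen G (fun x => exists n, A n x)
| sg_ext A B : sigma_gen G A -> (forall x, A x <-> B x) -> sigma_gen G B.

Definition cantor_cyl (A : Cantor -> Prop) : Prop :=
  exists n b, forall x, A x <-> x n = b.

Definition borel (A : Cantor -> Prop) : Prop := sigma_gen cantor_cyl A.

Definition cantor2_cyl (A : Cantor * Cantor -> Prop) : Prop :=
  exists n b, (forall p, A p <-> fst p n = b) \/ (forall p, A p <-> snd p n = b).

Definition borel2 (A : Cantor * Cantor -> Prop) : Prop := sigma_gen cantor2_cyl A.

Definition borel_rel (R : Cantor -> Cantor -> Prop) : Prop :=
  borel2 (fun p => R (fst p) (snd p)).

(** f is Borel measurable on the (Borel) domain P: the preimage in P of every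
    Borel set is Borel (the values of f outside P are irrelevant). *)
Definition borel_measurable_on (P : Cantor -> Prop) (f : Cantor -> Cantor) : Prop :=
  forall B, borel B -> borel (fun x => P x /\ B (f x)).

(** ** Turing reducibility, via oracle register (counter) machines. *)
Inductive instr : Type :=
| Inc (r : nat)
| Dec (r : nat) (j : nat)
| Orc (r : nat).

Definition program := list instr.
Definition config := (nat * (nat -> nat))%type.

Definition upd (g : nat -> nat) (r v : nat) : nat -> nat :=
  fun i => if Nat.eqb i r then v else g i.

Definition halted (p : program) (c : config) : Prop := nth_error p (fst c) = None.

Definition step (A : Cantor) (p : program) (c : config) : config :=
  let (pc, g) := c in
  match nth_error p pc with
  | None => c
  | Some (Inc r) => (S pc, upd g r (S (g r)))
  | Some (Dec r j) => match g r with
                      | 0 => (j, g)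
                      | S k => (S pc, upd g r k)
                      end
  | Some (Orc r) => (S pc, upd g r (if A (g r) then 1 else 0))
  end.

Fixpoint run (A : Cantor) (p : program) (fuel : nat) (c : config) : config :=
  match fuel with
  | 0 => c
  | S k => run A p k (step A p c)
  end.

Definition init (n : nat) : config := (0, fun i => if Nat.eqb i 0 then n else 0).

Definition halts_with (A : Cantor) (p : program) (n v : nat) : Prop :=
  exists k, halted p (run A p k (init n)) /\ snd (run A p k (init n)) 0 = v.

Definition turing_le (x y : Cantor) : Prop :=
  exists p : program, forall n, halts_with y p n (if x n then 1 else 0).

Definition partial_order_on (P : Cantor -> Prop) (le : Cantor -> Cantor -> Prop) : Prop :=
  (forall x y, le x y -> P x /\ P y) /\
  (forall x, P x -> le x x) /\
  (forall x y, le x y -> le y x -> x = y) /\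
  (forall x y z, le x y -> le y z -> le x z).

Definition borel_partial_order (P : Cantor -> Prop) (le : Cantor -> Cantor -> Prop) : Prop :=
  borel P /\ borel_rel le /\ partial_order_on P le.

Definition strict_lt (le : Cantor -> Cantor -> Prop) (x y : Cantor) : Prop :=
  le x y /\ x <> y.

Definition locally_countable (P : Cantor -> Prop) (le : Cantor -> Cantor -> Prop) : Prop :=
  forall y, P y -> exists g : nat -> Cantor, forall x, strict_lt le x y -> exists n, g n = x.

Definition chain_of_length (P : Cantor -> Prop) (le : Cantor -> Cantor -> Prop)
    (k : nat) (c : nat -> Cantor) : Prop :=
  (forall i, i < k -> P (c i)) /\
  (forall i, S i < k -> strict_lt le (c i) (c (S i))).

Definition has_height (P : Cantor -> Prop) (le : Cantor -> Cantor -> Prop) (n : nat) : Prop :=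
  (exists c, chain_of_length P le n c) /\
  (forall k c, chain_of_length P le k c -> k <= n).

Definition borel_embedding_into_turing (P : Cantor -> Prop) (le : Cantor -> Cantor -> Prop)
    (f : Cantor -> Cantor) : Prop :=
  borel_measurable_on P f /\
  (forall x y, P x -> P y -> (le x y <-> turing_le (f x) (f y))).

(* Main.v *)
From Stdlib Require Import List Arith Lia Bool.
From Stdlib Require Import FunctionalExtensionality Classical ClassicalEpsilon.
Require Import Defs.
Import ListNotations.

(** The order has three levels: points (reals), sequences of points, and level three
    sequences, which lie above one level two sequence and further points.

    Suppose that [f] is a Borel embedding.  It is continuous on a perfect set of
    points; reparametrise this set to get a continuous injection [F] of Cantor space.
    Let [z] be the image of a level two element lying above a dense set of points of
    the perfect set.  Then for every real [x] there are four points of the perfect set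
    whose [F]-images compute [x] together with [z]: each of the four reals follows,
    for longer and longer, one [F]-image of the dense set after another, and the
    levels at which it departs from them carry the bits of [x] as well as enough
    information to recover, by bounded simulation of programs with oracle [z], which
    real is being followed.  So the image of the level three element above these
    points and above the level two element computes [x].  Taking for [x] the image of
    a point outside the perfect set contradicts that [f] is an embedding. *)

(** * Structured programs for counter machines *)

(** The obstacle is that programs with oracle [z] can be simulated only for bounded time, so
    finitely much data never settles which real a coded real is following. Two reals per group
    answer this: departures at levels [m < t] announce at once how much of the other group to
    inspect and how long to simulate, while their order remains free to carry a bit. The group
    inspected with these bounds must itself stay on its reals below [m], so two groups alternate,
    which makes four reals. Only images of eventually zero arguments are followed: these are
    countable and dense, so a single [z] computes all of them and a level two element can supply it.
    A third level is then needed to put [z] and four further points under one element, and listing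
    predecessors as rows keeps the order locally countable. On the machine side, functions primitive
    recursive in an oracle are compiled to counter machines, and one unbounded search is added on
    top. *)

Inductive cmd : Type :=
| CInc (r : nat)
| CSeq (c1 c2 : cmd)
| CWhile (r : nat) (c : cmd)
| CSkip
| CCall (p : program) (b : nat).

Fixpoint csize (c : cmd) : nat :=
  match c with
  | CInc _ => 1
  | CSeq c1 c2 => csize c1 + csize c2
  | CWhile _ c => csize c + 2
  | CSkip => 0
  | CCall p _ => length p
  end.

(** A stand-alone program may halt at any address past its end, so jump targets are clipped to
    [len]; the block is then always left at its end. *)
Definition relocate (off len b : nat) (i : instr) : instr :=
  match i with
  | Inc r => Inc (b + r)
  | Dec r j => Dec (b + r) (off + Nat.min j len)
  | Orc r => Orc (b + r)
  end.

(* Register 1 is reserved: it always holds 0, so [Dec 1 j] is an unconditional jump. *)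
Fixpoint compile (c : cmd) (off : nat) : program :=
  match c with
  | CInc r => [Inc r]
  | CSeq c1 c2 => compile c1 off ++ compile c2 (off + csize c1)
  | CWhile r c => Dec r (off + (csize c + 2)) :: compile c (S off) ++ [Dec 1 off]
  | CSkip => []
  | CCall p b => map (relocate off (length p) b) p
  end.

(** The side conditions [r <> 1] and [1 < b] protect register 1. A called program sees the registers
    from [b] on as its own registers from 0 on. *)
Inductive exec (A : Cantor) : cmd -> (nat -> nat) -> (nat -> nat) -> Prop :=
| EInc r g : r <> 1 -> exec A (CInc r) g (upd g r (S (g r)))
| ESeq c1 c2 g g1 g2 :
    exec A c1 g g1 -> exec A c2 g1 g2 -> exec A (CSeq c1 c2) g g2
| EWhile0 r c g : g r = 0 -> exec A (CWhile r c) g g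
| EWhileS r c g k g1 g2 :
    g r = S k -> r <> 1 -> exec A c (upd g r k) g1 ->
    exec A (CWhile r c) g1 g2 -> exec A (CWhile r c) g g2
| ESkip g : exec A CSkip g g
| ECall p b g k pc h :
    1 < b -> run A p k (0, fun i => g (b + i)) = (pc, h) -> halted p (pc, h) ->
    exec A (CCall p b) g (fun r => if r <? b then g r else h (r - b)).

Lemma compile_length c off : length (compile c off) = csize c.
Proof.
  revert off; induction c; intros off; simpl; auto.
  - now rewrite length_app, IHc1, IHc2.
  - rewrite length_app, IHc; simpl; lia.
  - now rewrite length_map.
Qed.

Lemma run_add A p j k c : run A p (j + k) c = run A p k (run A p j c).
Proof. revert c; induction j; intros c; simpl; auto. Qed.

Definition embedded (P : program) (off : nat) (q : program) : Prop :=
  forall i, i < length q -> nth_error P (off + i) = nth_error q i.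

Lemma embedded_app P off q1 q2 :
  embedded P off (q1 ++ q2) ->
  embedded P off q1 /\ embedded P (off + length q1) q2.
Proof.
  intros H; split; intros i Hi.
  - rewrite H by (rewrite length_app; lia). now apply nth_error_app1.
  - rewrite <- Nat.add_assoc, H by (rewrite length_app; lia).
    rewrite nth_error_app2 by lia. f_equal; lia.
Qed.

Lemma embedded_head P off i q :
  embedded P off (i :: q) -> nth_error P off = Some i.
Proof. intros H. specialize (H 0); simpl in H. rewrite Nat.add_0_r in H. apply H; lia. Qed.

Ltac upd_solve :=
  try (apply functional_extensionality; intro);
  unfold upd in *;
  repeat match goal with
  | |- context [Nat.eqb ?a ?b] => destruct (Nat.eqb_spec a b); subst
  | |- context [Nat.ltb ?a ?b] => destruct (Nat.ltb_spec a b); subst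
  end; try lia; try congruence; auto.

(** The invariant sends the callee's counter [pc] to [off + Nat.min pc (length p)], which merges all
    its halting addresses into the exit of the block. *)
Lemma call_simulation A P p off b :
  embedded P off (map (relocate off (length p) b) p) ->
  forall k pc g pc' h',
    run A p k (pc, fun i => g (b + i)) = (pc', h') -> halted p (pc', h') ->
    exists k', run A P k' (off + Nat.min pc (length p), g)
      = (off + length p, fun r => if r <? b then g r else h' (r - b)).
Proof.
  intros HP. induction k as [|k IH]; intros pc g pc' h' Hrun Hhalt.
  - simpl in Hrun; injection Hrun as <- <-.
    unfold halted in Hhalt; simpl in Hhalt.
    apply nth_error_None in Hhalt.
    exists 0; simpl. f_equal; [lia|].
    upd_solve. f_equal; lia.
  - simpl in Hrun. destruct (nth_error p pc) as [i|] eqn:E.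
    + assert (Hlt : pc < length p) by (apply nth_error_Some; congruence).
      assert (HPi : nth_error P (off + pc) = Some (relocate off (length p) b i)).
      { rewrite HP by (now rewrite length_map). now rewrite nth_error_map, E. }
      destruct i as [r|r j|r]; simpl in HPi.
      * replace (upd (fun i => g (b + i)) r (S (g (b + r)))) with
          (fun i => upd g (b + r) (S (g (b + r))) (b + i)) in Hrun by upd_solve.
        destruct (IH _ _ _ _ Hrun Hhalt) as [k' Hk'].
        exists (S k'). simpl. rewrite Nat.min_l by lia. rewrite HPi.
        rewrite Nat.min_l in Hk' by lia.
        rewrite Nat.add_succ_r in Hk'. rewrite Hk'. f_equal. upd_solve.
      * destruct (g (b + r)) as [|v] eqn:Ev.
        -- destruct (IH _ _ _ _ Hrun Hhalt) as [k' Hk'].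
           exists (S k'). simpl. rewrite Nat.min_l by lia. rewrite HPi, Ev. exact Hk'.
        -- replace (upd (fun i => g (b + i)) r v) with
             (fun i => upd g (b + r) v (b + i)) in Hrun by upd_solve.
           destruct (IH _ _ _ _ Hrun Hhalt) as [k' Hk'].
           exists (S k'). simpl. rewrite Nat.min_l by lia. rewrite HPi, Ev.
           rewrite Nat.min_l in Hk' by lia.
           rewrite Nat.add_succ_r in Hk'. rewrite Hk'. f_equal. upd_solve.
      * set (v := if A (g (b + r)) then 1 else 0) in *.
        replace (upd (fun i => g (b + i)) r v) with
          (fun i => upd g (b + r) v (b + i)) in Hrun by upd_solve.
        destruct (IH _ _ _ _ Hrun Hhalt) as [k' Hk'].
        exists (S k'). simpl. rewrite Nat.min_l by lia. rewrite HPi.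
        rewrite Nat.min_l in Hk' by lia.
        rewrite Nat.add_succ_r in Hk'. fold v. rewrite Hk'. f_equal. upd_solve.
    (* A halted callee idles through its remaining fuel; the host takes no step for it. *)
    + apply (IH _ _ _ _ Hrun Hhalt).
Qed.

(** That register 1 stays 0 is part of the induction, since the backward jump [Dec 1 off] of a loop
    depends on it. *)
Lemma compile_correct A c g g' :
  exec A c g g' -> g 1 = 0 -> forall P off, embedded P off (compile c off) ->
  (exists k, run A P k (off, g) = (off + csize c, g')) /\ g' 1 = 0.
Proof.
  induction 1 as [r g Hr | c1 c2 g g1 g2 H1 IH1 H2 IH2 | r c g H0
                 | r c g k g1 g2 HS Hr H1 IH1 H2 IH2 | g
                 | p b g k pc h Hb Hrun Hhalt]; intros Hz P off HP; simpl in *.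
  - split; [|upd_solve]. exists 1; simpl.
    rewrite (embedded_head _ _ _ _ HP). f_equal; lia.
  - apply embedded_app in HP; destruct HP as [HP1 HP2].
    rewrite compile_length in HP2.
    destruct (IH1 Hz _ _ HP1) as [[k1 E1] Hz1].
    destruct (IH2 Hz1 _ _ HP2) as [[k2 E2] Hz2].
    split; auto. exists (k1 + k2). rewrite run_add, E1, E2. f_equal; lia.
  - split; auto. exists 1; simpl. rewrite (embedded_head _ _ _ _ HP), H0. reflexivity.
  - pose proof (embedded_head _ _ _ _ HP) as Hhd.
    pose proof HP as HP0.
    change (Dec r (off + (csize c + 2)) :: compile c (S off) ++ [Dec 1 off])
      with ([Dec r (off + (csize c + 2))] ++ (compile c (S off) ++ [Dec 1 off])) in HP.
    apply embedded_app in HP; destruct HP as [_ HP]; simpl in HP.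
    rewrite Nat.add_1_r in HP.
    apply embedded_app in HP; destruct HP as [HPc HPj].
    apply embedded_head in HPj. rewrite compile_length in HPj; simpl in HPj.
    assert (Hz' : upd g r k 1 = 0) by upd_solve.
    destruct (IH1 Hz' _ _ HPc) as [[k1 E1] Hz1].
    destruct (IH2 Hz1 _ _ HP0) as [[k2 E2] Hz2].
    split; auto. exists (S (k1 + S k2)). simpl. rewrite Hhd, HS.
    rewrite run_add, E1. simpl. rewrite HPj, Hz1. exact E2.
  - split; auto. exists 0; simpl. f_equal; lia.
  - split; [|upd_solve].
    destruct (call_simulation A P p off b HP k 0 g pc h Hrun Hhalt) as [k' Hk'].
    simpl in Hk'. rewrite Nat.add_0_r in Hk'. eauto.
Qed.

Lemma exec_eq A c g g1 g2 : exec A c g g1 -> g1 = g2 -> exec A c g g2.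
Proof. now intros H <-. Qed.

(** * Basic register operations *)

Definition clear (r : nat) : cmd := CWhile r CSkip.
Definition move (r d : nat) : cmd := CWhile r (CInc d).
Definition copy (r d t : nat) : cmd :=
  CSeq (CWhile r (CSeq (CInc d) (CInc t))) (move t r).

Lemma exec_clear A r g : r <> 1 -> exec A (clear r) g (upd g r 0).
Proof.
  intros Hr. remember (g r) as n eqn:E. revert g E; induction n; intros g E.
  - eapply exec_eq; [apply EWhile0; congruence|]. upd_solve.
  - eapply EWhileS; [symmetry; exact E|assumption|apply ESkip|].
    eapply exec_eq; [apply IHn|]; upd_solve.
Qed.

Lemma exec_move A r d g :
  r <> 1 -> d <> 1 -> r <> d ->
  exec A (move r d) g (upd (upd g d (g d + g r)) r 0).
Proof.
  intros Hr Hd Hrd. remember (g r) as n eqn:E. revert g E; induction n; intros g E.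
  - eapply exec_eq; [apply EWhile0; congruence|]. upd_solve.
  - eapply EWhileS; [symmetry; exact E|assumption|now apply EInc|].
    eapply exec_eq; [apply IHn|]; upd_solve.
Qed.

Lemma exec_copy A r d t g :
  r <> 1 -> d <> 1 -> t <> 1 -> r <> d -> r <> t -> d <> t -> g d = 0 -> g t = 0 ->
  exec A (copy r d t) g (upd g d (g r)).
Proof.
  intros Hr Hd Ht Hrd Hrt Hdt Hd0 Ht0. eapply ESeq.
  - assert (H : forall n g, g r = n ->
      exec A (CWhile r (CSeq (CInc d) (CInc t))) g
        (upd (upd (upd g d (g d + n)) t (g t + n)) r 0)).
    { induction n; intros g' E.
      - eapply exec_eq; [apply EWhile0; congruence|]. upd_solve.
      - eapply EWhileS; [eassumption|assumption| |].
        + eapply ESeq; apply EInc; assumption.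
        + eapply exec_eq; [apply IHn|]; upd_solve. }
    apply H; reflexivity.
  - eapply exec_eq; [apply exec_move; auto|]. upd_solve.
Qed.

Fixpoint clear_range (b n : nat) : cmd :=
  match n with
  | 0 => CSkip
  | S n => CSeq (clear_range b n) (clear (b + n))
  end.

Lemma exec_clear_range A b n g :
  1 < b ->
  exec A (clear_range b n) g
    (fun r => if (b <=? r) && (r <? b + n) then 0 else g r).
Proof.
  intros Hb. induction n; simpl.
  - eapply exec_eq; [apply ESkip|]. apply functional_extensionality; intro r.
    destruct (Nat.leb_spec b r); simpl; auto. upd_solve.
  - eapply ESeq; [apply IHn|]. eapply exec_eq; [apply exec_clear; lia|].
    apply functional_extensionality; intro r. unfold upd.
    destruct (Nat.leb_spec b r); simpl; upd_solve.
Qed.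

Definition instr_reg (i : instr) : nat :=
  match i with Inc r => r | Dec r _ => r | Orc r => r end.

(** Bounds, uniformly in the oracle and the input, the registers to be cleaned after a call. *)
Lemma program_reg_bound (p : program) :
  exists N, forall A k c r, N <= r -> snd (run A p k c) r = snd c r.
Proof.
  assert (HN : exists N, forall i, In i p -> instr_reg i < N).
  { induction p as [|i p [N HN]].
    - exists 0; intros i [].
    - exists (S (N + instr_reg i)). intros j [<-|Hj]; [lia|]. specialize (HN j Hj); lia. }
  destruct HN as [N HN]. exists N. intros A k.
  induction k as [|k IH]; intros c r Hr; simpl; auto.
  rewrite IH by assumption. destruct c as [pc g]; simpl.
  destruct (nth_error p pc) as [i|] eqn:E; auto.
  apply nth_error_In in E. specialize (HN i E).
  destruct i as [q|q j|q]; simpl in *.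
  - upd_solve.
  - destruct (g q); simpl; upd_solve.
  - upd_solve.
Qed.

(** * Functions primitive recursive in an oracle *)

Definition env := nat -> nat.
Definition scons (n : nat) (e : env) : env :=
  fun i => match i with 0 => n | S i => e i end.

(* Functions of finitely many variables are encoded as functions of an infinite
   environment; all reals Turing below [A] are admitted as basic functions. *)
Inductive pr (A : Cantor) : (env -> nat) -> Prop :=
| pr_var i : pr A (fun e => e i)
| pr_zero : pr A (fun _ => 0)
| pr_succ f : pr A f -> pr A (fun e => S (f e))
| pr_orc J f : turing_le J A -> pr A f -> pr A (fun e => Nat.b2n (J (f e)))
| pr_rec b s n : pr A b -> pr A s -> pr A n ->
    pr A (fun e => nat_rect (fun _ => nat) (b e)
                     (fun k r => s (scons k (scons r e))) (n e))
| pr_let f g : pr A f -> pr A g -> pr A (fun e => f (scons (g e) e)).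

(** A calling convention: variable [i] lives in register [rho i] below [b], all registers from [b]
    on are zeroed scratch space, and in the end only register [b] has changed. *)
Definition cmd_computes (A : Cantor) (f : env -> nat) : Prop :=
  forall b rho, 1 < b -> (forall i, rho i < b /\ rho i <> 1) ->
  exists c, forall g, (forall r, b <= r -> g r = 0) ->
    exec A c g (upd g b (f (fun i => g (rho i)))).

Lemma cmd_computes_orc A J f :
  turing_le J A -> cmd_computes A f -> cmd_computes A (fun e => Nat.b2n (J (f e))).
Proof.
  intros [p Hp] IH b rho Hb Hrho.
  destruct (IH b rho Hb Hrho) as [c Hc].
  destruct (program_reg_bound p) as [N HN].
  exists (CSeq c (CSeq (CCall p b) (clear_range (S b) N))).
  intros g Hg. specialize (Hc g Hg). set (v := f (fun i => g (rho i))) in *.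
  destruct (Hp v) as [k [Hh Hv]].
  destruct (run A p k (init v)) as [pc h] eqn:E.
  eapply ESeq; [exact Hc|]. eapply ESeq.
  - eapply ECall with (k := k); [assumption| |exact Hh].
    rewrite <- E. f_equal. unfold init. f_equal.
    apply functional_extensionality; intro i. unfold upd.
    destruct (Nat.eqb_spec (b + i) b), (Nat.eqb_spec i 0); try lia. apply Hg; lia.
  - eapply exec_eq; [apply exec_clear_range; lia|].
    apply functional_extensionality; intro r. unfold upd.
    destruct (Nat.leb_spec (S b) r); simpl.
    + destruct (Nat.eqb_spec r b); [lia|].
      destruct (Nat.ltb_spec r (S (b + N))); [symmetry; apply Hg; lia|].
      destruct (Nat.ltb_spec r b); [lia|].
      specialize (HN A k (init v) (r - b)). rewrite E in HN; simpl in HN.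
      rewrite HN by lia. rewrite Hg by lia.
      destruct (Nat.eqb_spec (r - b) 0); lia.
    + destruct (Nat.ltb_spec r b).
      * destruct (Nat.eqb_spec r b); [lia|reflexivity].
      * replace (r - b) with 0 by lia. simpl in Hv. rewrite Hv.
        destruct (Nat.eqb_spec r b); [reflexivity|lia].
Qed.

Lemma cmd_computes_rec A fb fs fn :
  cmd_computes A fb -> cmd_computes A fs -> cmd_computes A fn ->
  cmd_computes A (fun e => nat_rect (fun _ => nat) (fb e)
                     (fun k r => fs (scons k (scons r e))) (fn e)).
Proof.
  intros Hb Hs Hn b rho H1 Hrho.
  assert (Hrho2 : forall i, rho i < b + 2 /\ rho i <> 1) by (intro i; specialize (Hrho i); lia).
  assert (Hrho3 : forall i, scons (b + 1) (scons (b + 2) rho) i < b + 3 /\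
                            scons (b + 1) (scons (b + 2) rho) i <> 1).
  { intros [|[|i]]; simpl; try lia. specialize (Hrho i); lia. }
  destruct (Hn b rho H1 Hrho) as [cn Hcn].
  destruct (Hb (b + 2) rho ltac:(lia) Hrho2) as [cb Hcb].
  destruct (Hs (b + 3) _ ltac:(lia) Hrho3) as [cs Hcs].
  (* Register [b] counts the remaining rounds, [b + 1] the rounds done, [b + 2] holds the
     accumulator and [b + 3] receives its next value. *)
  exists (CSeq cn (CSeq cb (CSeq
    (CWhile b (CSeq cs (CSeq (clear (b + 2)) (CSeq (move (b + 3) (b + 2)) (CInc (b + 1))))))
    (CSeq (clear (b + 1)) (move (b + 2) b))))).
  intros g Hg. set (e := fun i => g (rho i)).
  set (F := nat_rect (fun _ => nat) (fb e) (fun k r => fs (scons k (scons r e)))).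
  set (st := fun n k => upd (upd (upd g b n) (b + 1) k) (b + 2) (F k)).
  assert (He : forall n k, (fun i => st n k (rho i)) = e).
  { intros n k. apply functional_extensionality; intro i. unfold st, e.
    specialize (Hrho i). upd_solve. }
  eapply ESeq; [apply Hcn; exact Hg|]. fold e.
  eapply ESeq.
  { apply Hcb. intros r Hr. specialize (Hg r). upd_solve. }
  eapply ESeq with (g1 := st 0 (fn e)).
  - assert (Hloop : forall n k, exec A
       (CWhile b (CSeq cs (CSeq (clear (b + 2)) (CSeq (move (b + 3) (b + 2)) (CInc (b + 1))))))
       (st n k) (st 0 (k + n))).
    { induction n; intros k.
      - rewrite Nat.add_0_r. apply EWhile0. unfold st; upd_solve.
      - eapply EWhileS with (k := n); [unfold st; upd_solve|lia| |].
        + replace (upd (st (S n) k) b n) with (st n k) by (unfold st; upd_solve).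
          eapply ESeq.
          { apply Hcs. intros r Hr. specialize (Hg r). unfold st; upd_solve. }
          replace (fun i => st n k (scons (b + 1) (scons (b + 2) rho) i))
            with (scons k (scons (F k) e)).
          2:{ apply functional_extensionality; intros [|[|i]]; simpl.
              - unfold st; upd_solve.
              - unfold st; upd_solve.
              - symmetry; apply (equal_f (He n k) i). }
          eapply ESeq; [apply exec_clear; lia|].
          eapply ESeq; [apply exec_move; lia|].
          apply EInc; lia.
        + eapply exec_eq; [|instantiate (1 := st 0 (S k + n)); f_equal; lia].
          match goal with |- exec _ _ ?h _ => replace h with (st n (S k)) end.
          { apply IHn. }
          assert (Hg3 : g (b + 3) = 0) by (apply Hg; lia).
          unfold st. change (F (S k)) with (fs (scons k (scons (F k) e))). upd_solve. }
    match goal with |- exec _ _ ?h _ => replace h with (st (fn e) 0) end.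
    { apply Hloop. }
    assert (Hg1 : g (b + 1) = 0) by (apply Hg; lia).
    assert (E : (fun i => upd g b (fn e) (rho i)) = e).
    { apply functional_extensionality; intro i. specialize (Hrho i). unfold e. upd_solve. }
    rewrite E. unfold st. change (F 0) with (fb e). upd_solve.
  - eapply ESeq; [apply exec_clear; lia|].
    eapply exec_eq; [apply exec_move; lia|].
    assert (Hg1 : g (b + 1) = 0) by (apply Hg; lia).
    assert (Hg2 : g (b + 2) = 0) by (apply Hg; lia).
    unfold st. upd_solve.
Qed.

Lemma pr_cmd_computes A f : pr A f -> cmd_computes A f.
Proof.
  induction 1 as [i| |f Hf IH|J f HJ Hf IH|fb fs fn Hb IHb Hs IHs Hn IHn|f h Hf IHf Hh IHh].
  - intros b rho Hb Hrho. exists (copy (rho i) b (b + 1)). intros g Hg.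
    specialize (Hrho i). apply exec_copy; try lia; apply Hg; lia.
  - intros b rho Hb Hrho. exists CSkip. intros g Hg.
    eapply exec_eq; [apply ESkip|]. specialize (Hg b). upd_solve.
  - intros b rho Hb Hrho. destruct (IH b rho Hb Hrho) as [c Hc].
    exists (CSeq c (CInc b)). intros g Hg. eapply ESeq; [now apply Hc|].
    eapply exec_eq; [apply EInc; lia|]. upd_solve.
  - now apply cmd_computes_orc.
  - now apply cmd_computes_rec.
  - intros b rho Hb Hrho. destruct (IHh b rho Hb Hrho) as [c Hc].
    assert (Hrho' : forall i, scons b rho i < b + 1 /\ scons b rho i <> 1).
    { intros [|i]; simpl; try lia. specialize (Hrho i); lia. }
    destruct (IHf (b + 1) _ ltac:(lia) Hrho') as [c' Hc'].
    exists (CSeq c (CSeq c' (CSeq (clear b) (move (b + 1) b)))). intros g Hg.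
    eapply ESeq; [now apply Hc|]. eapply ESeq.
    { apply Hc'. intros r Hr. specialize (Hg r). upd_solve. }
    eapply ESeq; [apply exec_clear; lia|].
    eapply exec_eq; [apply exec_move; lia|].
    assert (Hg1 : g (b + 1) = 0) by (apply Hg; lia).
    match goal with |- context [f ?a] =>
      replace a with (scons (h (fun i => g (rho i))) (fun i => g (rho i))) end.
    { upd_solve. }
    apply functional_extensionality; intros [|i]; simpl.
    + upd_solve.
    + specialize (Hrho i). upd_solve.
Qed.

(** One unbounded search over [T] is enough: [h] answers 0 until it knows the bit, and all nonzero
    answers agree, so the first one found is right. *)
Lemma turing_le_search A x (h : env -> nat) :
  pr A h ->
  (forall n, exists T, h (scons T (fun _ => n)) <> 0) ->
  (forall n T, h (scons T (fun _ => n)) <> 0 ->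
     h (scons T (fun _ => n)) = S (Nat.b2n (x n))) ->
  turing_le x A.
Proof.
  intros Hh Hex Hval.
  destruct (pr_cmd_computes A h Hh 4 (scons 3 (fun _ => 0))) as [c Hc].
  { lia. }
  { intros [|i]; simpl; lia. }
  (* Register 0 holds the input, 2 the flag for continuing, 3 the bound [T], 4 the answer of [h] and
     5 the output; a nonzero answer lowers the flag just raised. *)
  set (body := CSeq c (CSeq (CInc 3) (CSeq (CInc 2)
                 (CWhile 4 (CSeq (clear 2) (CInc 5)))))).
  (* In [CWhile 5 (move 5 0)] the loop test strips the successor off the answer; the body moves the
     bit to register 0 and thereby ends the loop. *)
  set (prog := CSeq (CInc 2) (CSeq (CWhile 2 body)
                 (CSeq (clear 0) (CWhile 5 (move 5 0))))).
  exists (compile prog 0). intros n.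
  set (st := fun flag T out r =>
     match r with 0 => n | 2 => flag | 3 => T | 5 => out | _ => 0 end).
  assert (Hin : forall f T, (fun i => st f T 0 (scons 3 (fun _ => 0) i)) = scons T (fun _ => n)).
  { intros f T. apply functional_extensionality; intros [|i]; reflexivity. }
  assert (Hc' : forall T, exec A c (st 0 T 0) (upd (st 0 T 0) 4 (h (scons T (fun _ => n))))).
  { intros T. rewrite <- (Hin 0). apply Hc.
    intros r Hr. do 6 (destruct r as [|r]; [simpl; lia|]). reflexivity. }
  assert (Hdrain : forall v f T o, exec A (CWhile 4 (CSeq (clear 2) (CInc 5)))
      (upd (st f T o) 4 v) (st (match v with 0 => f | _ => 0 end) T (o + v))).
  { induction v; intros f T o.
    - eapply exec_eq; [apply EWhile0; upd_solve|].
      apply functional_extensionality; intro r. unfold upd.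
      do 6 (destruct r as [|r]; [simpl; lia|]). reflexivity.
    - eapply EWhileS with (k := v); [upd_solve|lia| |].
      + eapply ESeq; [apply exec_clear; lia|apply EInc; lia].
      + eapply exec_eq; [|instantiate (1 := st 0 T (S o + v)); f_equal; lia].
        match goal with |- exec _ _ ?h _ => replace h with (upd (st 0 T (S o)) 4 v) end.
        * specialize (IHv 0 T (S o)). destruct v; exact IHv.
        * apply functional_extensionality; intro r. unfold upd.
          do 6 (destruct r as [|r]; [simpl; lia|]). reflexivity. }
  assert (Hloop : forall d T, h (scons (d + T) (fun _ => n)) <> 0 ->
     exists T', exec A (CWhile 2 body) (st 1 T 0) (st 0 T' (S (Nat.b2n (x n))))).
  { assert (Hbody : forall T, let v := h (scons T (fun _ => n)) in
      exec A body (st 0 T 0) (st (match v with 0 => 1 | _ => 0 end) (S T) v)).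
    { intros T v. eapply ESeq; [apply Hc'|]. fold v.
      eapply ESeq; [apply EInc; lia|]. eapply ESeq; [apply EInc; lia|].
      match goal with |- exec _ _ ?h _ => replace h with (upd (st 1 (S T) 0) 4 v) end.
      - exact (Hdrain v 1 (S T) 0).
      - apply functional_extensionality; intro r. unfold upd.
        do 6 (destruct r as [|r]; [simpl; lia|]). reflexivity. }
    assert (H10 : forall T, upd (st 1 T 0) 2 0 = st 0 T 0).
    { intros T. apply functional_extensionality; intro r. unfold upd.
      do 6 (destruct r as [|r]; [simpl; lia|]). reflexivity. }
    induction d; intros T Hd; specialize (Hbody T); cbv zeta in Hbody;
      destruct (h (scons T (fun _ => n))) as [|v] eqn:Ev.
    - now destruct Hd.
    - exists (S T). eapply EWhileS with (k := 0); [reflexivity|lia|rewrite H10; exact Hbody|].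
      assert (E := Hval n T ltac:(congruence)). rewrite Ev in E. rewrite E.
      apply EWhile0. reflexivity.
    - destruct (IHd (S T)) as [T' HT']; [now rewrite Nat.add_succ_r|].
      exists T'. eapply EWhileS with (k := 0); [reflexivity|lia|rewrite H10; exact Hbody|].
      exact HT'.
    - exists (S T). eapply EWhileS with (k := 0); [reflexivity|lia|rewrite H10; exact Hbody|].
      assert (E := Hval n T ltac:(congruence)). rewrite Ev in E. rewrite E.
      apply EWhile0. reflexivity. }
  destruct (Hex n) as [T0 HT0].
  destruct (Hloop T0 0) as [T' HT']; [now rewrite Nat.add_0_r|].
  assert (Hexec : exists g', exec A prog (snd (init n)) g' /\ g' 0 = Nat.b2n (x n)).
  { eexists; split.
    - eapply ESeq; [apply EInc; lia|]. eapply ESeq.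
      { match goal with |- exec _ _ ?h _ => replace h with (st 1 0 0) end; [exact HT'|].
        apply functional_extensionality; intro r. unfold upd.
        do 6 (destruct r as [|r]; [simpl; lia|]). reflexivity. }
      eapply ESeq; [apply exec_clear; lia|].
      eapply EWhileS; [reflexivity|lia|apply exec_move; lia|].
      apply EWhile0. reflexivity.
    - reflexivity. }
  destruct Hexec as [g' [Hexec Hg']].
  destruct (compile_correct A prog _ g' Hexec eq_refl (compile prog 0) 0) as [[k Hk] _].
  { intros i _. reflexivity. }
  exists k. unfold init in *. cbn [snd] in Hk. rewrite Hk. split.
  - unfold halted; cbn [fst]. apply nth_error_None. rewrite compile_length; lia.
  - exact Hg'.
Qed.

(** As in any calculus with binders, renaming precedes substitution: it weakens the substituted
    functions under the variables bound by [pr_rec] and [pr_let]. *)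
Lemma pr_rename A f : pr A f -> forall rho, pr A (fun e => f (fun i => e (rho i))).
Proof.
  induction 1 as [i| |f Hf IH|J f HJ Hf IH|b s n Hb IHb Hs IHs Hn IHn|f h Hf IHf Hh IHh];
    intros rho.
  - apply pr_var.
  - apply pr_zero.
  - apply pr_succ, IH.
  - apply pr_orc; auto.
  - set (rho' := fun i => match i with 0 => 0 | 1 => 1 | S (S i) => S (S (rho i)) end).
    pose proof (pr_rec A _ _ _ (IHb rho) (IHs rho') (IHn rho)) as H.
    match type of H with pr A ?f1 => match goal with |- pr A ?f2 =>
      replace f2 with f1; [exact H|] end end.
    apply functional_extensionality; intro e. f_equal.
    apply functional_extensionality; intro k. apply functional_extensionality; intro r.
    f_equal. apply functional_extensionality; intros [|[|i]]; reflexivity.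
  - set (rho' := fun i => match i with 0 => 0 | S i => S (rho i) end).
    pose proof (pr_let A _ _ (IHf rho') (IHh rho)) as H.
    match type of H with pr A ?f1 => match goal with |- pr A ?f2 =>
      replace f2 with f1; [exact H|] end end.
    apply functional_extensionality; intro e.
    f_equal. apply functional_extensionality; intros [|i]; reflexivity.
Qed.

Lemma pr_subst A f : pr A f -> forall s : nat -> env -> nat,
  (forall i, pr A (s i)) -> pr A (fun e => f (fun i => s i e)).
Proof.
  induction 1 as [i| |f Hf IH|J f HJ Hf IH|b st n Hb IHb Hs IHs Hn IHn|f h Hf IHf Hh IHh];
    intros s Hsub.
  - apply Hsub.
  - apply pr_zero.
  - apply pr_succ; auto.
  - apply pr_orc; auto.
  - set (s' := fun i (e : env) => match i with 0 => e 0 | 1 => e 1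
                        | S (S i) => s i (fun j => e (S (S j))) end).
    assert (Hs' : forall i, pr A (s' i)).
    { intros [|[|i]]; [apply pr_var|apply pr_var|].
      apply (pr_rename A _ (Hsub i) (fun j => S (S j))). }
    exact (pr_rec A _ _ _ (IHb s Hsub) (IHs s' Hs') (IHn s Hsub)).
  - set (s' := fun i (e : env) => match i with 0 => e 0 | S i => s i (fun j => e (S j)) end).
    assert (Hs' : forall i, pr A (s' i)).
    { intros [|i]; [apply pr_var|]. apply (pr_rename A _ (Hsub i) S). }
    exact (pr_let A _ _ (IHf s' Hs') (IHh s Hsub)).
Qed.

(** * Closure properties of primitive recursion in an oracle *)

Lemma pr_const A n : pr A (fun _ => n).
Proof. induction n; [apply pr_zero|now apply pr_succ]. Qed.

Definition pr1 A (h : nat -> nat) := pr A (fun e => h (e 0)).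
Definition pr2 A (h : nat -> nat -> nat) := pr A (fun e => h (e 0) (e 1)).
Definition pr3 A (h : nat -> nat -> nat -> nat) := pr A (fun e => h (e 0) (e 1) (e 2)).

Lemma pr_comp1 A h f : pr1 A h -> pr A f -> pr A (fun e => h (f e)).
Proof. intros Hh Hf. exact (pr_subst A _ Hh (fun _ => f) (fun _ => Hf)). Qed.

Lemma pr_comp2 A h f1 f2 :
  pr2 A h -> pr A f1 -> pr A f2 -> pr A (fun e => h (f1 e) (f2 e)).
Proof.
  intros Hh H1 H2.
  apply (pr_subst A _ Hh (fun i => match i with 0 => f1 | _ => f2 end)).
  intros [|i]; assumption.
Qed.

Lemma pr_comp3 A h f1 f2 f3 :
  pr3 A h -> pr A f1 -> pr A f2 -> pr A f3 -> pr A (fun e => h (f1 e) (f2 e) (f3 e)).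
Proof.
  intros Hh H1 H2 H3.
  apply (pr_subst A _ Hh (fun i => match i with 0 => f1 | 1 => f2 | _ => f3 end)).
  intros [|[|i]]; assumption.
Qed.

Lemma pr_iter A (b n : env -> nat) (s : nat -> nat -> env -> nat) :
  pr A b -> pr A (fun e => s (e 0) (e 1) (fun i => e (S (S i)))) -> pr A n ->
  pr A (fun e => nat_rect (fun _ => nat) (b e) (fun k r => s k r e) (n e)).
Proof. intros Hb Hs Hn. exact (pr_rec A _ _ _ Hb Hs Hn). Qed.

Lemma pr_pred A : pr1 A Nat.pred.
Proof.
  assert (H : pr A (fun e => nat_rect (fun _ => nat) 0 (fun k _ => k) (e 0))).
  { apply (pr_iter A _ _ (fun k _ _ => k)); [apply pr_zero| |]; apply pr_var. }
  red. match goal with |- pr A ?f => replace f with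
    (fun e : env => nat_rect (fun _ => nat) 0 (fun k _ => k) (e 0)) end; auto.
  apply functional_extensionality; intro e. now destruct (e 0).
Qed.

Lemma pr_add A : pr2 A Nat.add.
Proof.
  assert (H : pr A (fun e => nat_rect (fun _ => nat) (e 1) (fun _ r => S r) (e 0))).
  { apply (pr_iter A _ _ (fun _ r _ => S r)); [apply pr_var| |apply pr_var].
    apply pr_succ, pr_var. }
  red. match goal with |- pr A ?f => replace f with
    (fun e : env => nat_rect (fun _ => nat) (e 1) (fun _ r => S r) (e 0)) end; auto.
  apply functional_extensionality; intro e. induction (e 0); simpl; auto.
Qed.

Lemma pr_sub A : pr2 A Nat.sub.
Proof.
  assert (H : pr A (fun e => nat_rect (fun _ => nat) (e 0) (fun _ r => Nat.pred r) (e 1))).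
  { apply (pr_iter A _ _ (fun _ r _ => Nat.pred r)); [apply pr_var| |apply pr_var].
    apply (pr_comp1 A Nat.pred); [apply pr_pred|apply pr_var]. }
  red. match goal with |- pr A ?f => replace f with
    (fun e : env => nat_rect (fun _ => nat) (e 0) (fun _ r => Nat.pred r) (e 1)) end; auto.
  apply functional_extensionality; intro e. induction (e 1); simpl; lia.
Qed.

Lemma pr_ifz A f g h :
  pr A f -> pr A g -> pr A h ->
  pr A (fun e => match f e with 0 => g e | S _ => h e end).
Proof.
  intros Hf Hg Hh.
  assert (H : pr A (fun e => nat_rect (fun _ => nat) (g e) (fun _ _ => h e) (f e))).
  { apply (pr_iter A _ _ (fun _ _ e => h e)); auto.
    apply (pr_rename A _ Hh (fun i => S (S i))). }
  match goal with |- pr A ?f' => replace f' with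
    (fun e : env => nat_rect (fun _ => nat) (g e) (fun _ _ => h e) (f e)) end; auto.
  apply functional_extensionality; intro e. now destruct (f e).
Qed.

Definition prb A (p : env -> bool) := pr A (fun e => Nat.b2n (p e)).

Lemma pr_ite A p f g :
  prb A p -> pr A f -> pr A g -> pr A (fun e => if p e then f e else g e).
Proof.
  intros Hp Hf Hg. pose proof (pr_ifz A _ _ _ Hp Hg Hf) as H.
  match type of H with pr A ?f1 => match goal with |- pr A ?f2 =>
    replace f2 with f1; [exact H|] end end.
  apply functional_extensionality; intro e. now destruct (p e).
Qed.

Lemma prb_oracle A J f : turing_le J A -> pr A f -> prb A (fun e => J (f e)).
Proof. apply pr_orc. Qed.

Lemma prb_ite A p q r :
  prb A p -> prb A q -> prb A r -> prb A (fun e => if p e then q e else r e).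
Proof.
  intros Hp Hq Hr. pose proof (pr_ite A _ _ _ Hp Hq Hr) as H.
  red. match type of H with pr A ?f1 => match goal with |- pr A ?f2 =>
    replace f2 with f1; [exact H|] end end.
  apply functional_extensionality; intro e. now destruct (p e).
Qed.

Lemma prb_const A b : prb A (fun _ => b).
Proof. exact (pr_const A (Nat.b2n b)). Qed.

Lemma prb_negb A p : prb A p -> prb A (fun e => negb (p e)).
Proof. intros Hp. apply prb_ite; auto; apply prb_const. Qed.

Lemma prb_andb A p q : prb A p -> prb A q -> prb A (fun e => andb (p e) (q e)).
Proof. intros Hp Hq. apply prb_ite; auto; apply prb_const. Qed.

Lemma prb_orb A p q : prb A p -> prb A q -> prb A (fun e => orb (p e) (q e)).
Proof. intros Hp Hq. apply prb_ite; auto; apply prb_const. Qed.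

Lemma prb_leb A f g : pr A f -> pr A g -> prb A (fun e => f e <=? g e).
Proof.
  intros Hf Hg.
  pose proof (pr_ifz A _ _ _ (pr_comp2 A _ _ _ (pr_sub A) Hf Hg)
                (pr_const A 1) (pr_const A 0)) as H.
  red. match type of H with pr A ?f1 => match goal with |- pr A ?f2 =>
    replace f2 with f1; [exact H|] end end.
  apply functional_extensionality; intro e.
  destruct (Nat.leb_spec (f e) (g e)), (f e - g e) eqn:E; simpl; lia.
Qed.

Lemma prb_ltb A f g : pr A f -> pr A g -> prb A (fun e => f e <? g e).
Proof. intros Hf Hg. apply (prb_leb A (fun e => S (f e))); auto. now apply pr_succ. Qed.

Lemma prb_eqb A f g : pr A f -> pr A g -> prb A (fun e => f e =? g e).
Proof.
  intros Hf Hg.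
  pose proof (prb_andb A _ _ (prb_leb A _ _ Hf Hg) (prb_leb A _ _ Hg Hf)) as H.
  red. match type of H with prb A ?f1 => match goal with |- pr A ?f2 =>
    replace f2 with (fun e => Nat.b2n (f1 e)); [exact H|] end end.
  apply functional_extensionality; intro e.
  destruct (Nat.leb_spec (f e) (g e)), (Nat.leb_spec (g e) (f e)),
    (Nat.eqb_spec (f e) (g e)); simpl; lia.
Qed.

(* The least [k < n] with [p k], or [n] if there is none. *)
Definition bmin (p : nat -> bool) (n : nat) : nat :=
  nat_rect (fun _ => nat) 0 (fun k r => if r <? k then r else if p k then k else S k) n.

Lemma bmin_spec p n :
  bmin p n <= n /\ (forall k, k < bmin p n -> p k = false) /\
  (bmin p n < n -> p (bmin p n) = true).
Proof.
  induction n as [|n [H1 [H2 H3]]]; simpl.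
  - split; [lia|split; [intros; lia|lia]].
  - fold (bmin p n). destruct (Nat.ltb_spec (bmin p n) n).
    + split; [lia|split; auto].
    + assert (bmin p n = n) by lia. destruct (p n) eqn:E.
      * split; [lia|split; auto]. intros k Hk; apply H2; lia.
      * split; [lia|split; [|lia]]. intros k Hk.
        destruct (Nat.eq_dec k n); [now subst|apply H2; lia].
Qed.

Lemma bmin_unique p n m :
  m < n -> p m = true -> (forall k, k < m -> p k = false) -> bmin p n = m.
Proof.
  intros Hm Hp Hlt. destruct (bmin_spec p n) as [H1 [H2 H3]].
  destruct (lt_eq_lt_dec (bmin p n) m) as [[H|H]|H]; auto.
  - rewrite Hlt in H3 by assumption. discriminate H3; lia.
  - rewrite H2 in Hp by assumption. discriminate.
Qed.

Lemma pr_bmin A (p : nat -> env -> bool) n :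
  prb A (fun e => p (e 0) (fun i => e (S i))) -> pr A n ->
  pr A (fun e => bmin (fun k => p k e) (n e)).
Proof.
  intros Hp Hn.
  apply (pr_iter A (fun _ => 0) n
    (fun k r e => if r <? k then r else if p k e then k else S k)).
  - apply pr_zero.
  - apply pr_ite; [apply prb_ltb; apply pr_var|apply pr_var|].
    apply pr_ite; [|apply pr_var|apply pr_succ, pr_var].
    apply (pr_rename A _ Hp (fun i => match i with 0 => 0 | S i => S (S i) end)).
  - assumption.
Qed.

Definition ball (p : nat -> bool) (n : nat) : bool :=
  bmin (fun k => negb (p k)) n =? n.

Lemma ball_true p n : ball p n = true <-> forall k, k < n -> p k = true.
Proof.
  unfold ball. destruct (bmin_spec (fun k => negb (p k)) n) as [H1 [H2 H3]].
  rewrite Nat.eqb_eq. split.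
  - intros E k Hk. rewrite E in H2. apply negb_false_iff. auto.
  - intros H. destruct (Nat.lt_ge_cases (bmin (fun k => negb (p k)) n) n); [|lia].
    specialize (H3 H0). rewrite H in H3 by assumption. discriminate.
Qed.

Lemma prb_ball A (p : nat -> env -> bool) n :
  prb A (fun e => p (e 0) (fun i => e (S i))) -> pr A n ->
  prb A (fun e => ball (fun k => p k e) (n e)).
Proof.
  intros Hp Hn. apply prb_eqb; auto.
  apply (pr_bmin A (fun k e => negb (p k e))); auto. now apply prb_negb.
Qed.

(** * Pairing and finitely supported sequences *)

Definition tri (n : nat) : nat := nat_rect (fun _ => nat) 0 (fun k r => S k + r) n.
Definition pair_nat (a b : nat) : nat := tri (a + b) + b.
(** The index of the diagonal containing [n] in Cantor's enumeration of pairs, found by counting up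
    so as to be visibly primitive recursive. *)
Definition diag (n : nat) : nat :=
  nat_rect (fun _ => nat) 0 (fun k r => if S k =? tri (S r) then S r else r) n.
Definition psnd (n : nat) : nat := n - tri (diag n).
Definition pfst (n : nat) : nat := diag n - psnd n.

Lemma tri_S n : tri (S n) = S n + tri n.
Proof. reflexivity. Qed.

Lemma tri_mono m n : m <= n -> tri m <= tri n.
Proof. induction 1; [lia|]. rewrite tri_S; lia. Qed.

Lemma diag_spec n : tri (diag n) <= n < tri (S (diag n)).
Proof.
  induction n as [|n IH]; [simpl; lia|].
  change (diag (S n)) with
    (if S n =? tri (S (diag n)) then S (diag n) else diag n).
  destruct (Nat.eqb_spec (S n) (tri (S (diag n)))) as [E|E].
  - rewrite (tri_S (S (diag n))). lia.
  - lia.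
Qed.

Lemma diag_pair a b : diag (pair_nat a b) = a + b.
Proof.
  pose proof (diag_spec (pair_nat a b)) as H. unfold pair_nat in *.
  set (d := diag (tri (a + b) + b)) in *.
  destruct (lt_eq_lt_dec d (a + b)) as [[H1|H1]|H1]; auto.
  - pose proof (tri_mono (S d) (a + b) H1). lia.
  - pose proof (tri_mono (S (a + b)) d H1) as H2. rewrite tri_S in H2. lia.
Qed.

Lemma psnd_pair a b : psnd (pair_nat a b) = b.
Proof. unfold psnd. rewrite diag_pair. unfold pair_nat. lia. Qed.

Lemma pfst_pair a b : pfst (pair_nat a b) = a.
Proof. unfold pfst. rewrite psnd_pair, diag_pair. lia. Qed.

Lemma pair_eta n : pair_nat (pfst n) (psnd n) = n.
Proof.
  pose proof (diag_spec n) as H. rewrite tri_S in H. unfold pair_nat.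
  assert (E : pfst n + psnd n = diag n) by (unfold pfst, psnd; lia).
  rewrite E. unfold psnd. lia.
Qed.

(** Iterated pairs code sequences. As 0 is the pair of 0 and 0, every number codes an eventually
    zero sequence, which suits register contents. *)
Definition drop (i s : nat) : nat := nat_rect (fun _ => nat) s (fun _ r => psnd r) i.
Definition get (i s : nat) : nat := pfst (drop i s).
Definition put (s r v : nat) : nat :=
  nat_rect (fun _ => nat) (pair_nat v (drop (S r) s))
    (fun j acc => pair_nat (get (r - S j) s) acc) r.

Lemma drop_S i s : drop (S i) s = drop i (psnd s).
Proof. induction i; [reflexivity|]. simpl. simpl in IHi. now rewrite IHi. Qed.

Lemma drop_add i j s : drop i (drop j s) = drop (j + i) s.
Proof. revert s; induction j; intros s; [reflexivity|].
  rewrite drop_S. rewrite IHj. simpl plus. now rewrite drop_S. Qed.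

Lemma get_0_pair a s : get 0 (pair_nat a s) = a.
Proof. apply pfst_pair. Qed.

Lemma get_S_pair i a s : get (S i) (pair_nat a s) = get i s.
Proof. unfold get. now rewrite drop_S, psnd_pair. Qed.

Lemma get_of_0 i : get i 0 = 0.
Proof.
  unfold get. replace (drop i 0) with 0; [reflexivity|].
  induction i; simpl; [reflexivity|]. now rewrite <- IHi.
Qed.

Lemma get_put i s r v : get i (put s r v) = if i =? r then v else get i s.
Proof.
  unfold put.
  set (R := nat_rect (fun _ => nat) (pair_nat v (drop (S r) s))
    (fun j acc => pair_nat (get (r - S j) s) acc)).
  (* [R j] codes the changed sequence from position [r - j] on. *)
  assert (H : forall j, j <= r -> forall i,
     get i (R j) = if i =? j then v else get (r - j + i) s).
  { induction j as [|j IH]; intros Hj k.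
    - change (R 0) with (pair_nat v (drop (S r) s)).
      destruct k as [|k]; [apply get_0_pair|].
      rewrite get_S_pair. simpl Nat.eqb. cbv iota. unfold get at 1. rewrite drop_add.
      unfold get. f_equal. f_equal. lia.
    - change (R (S j)) with (pair_nat (get (r - S j) s) (R j)).
      destruct k as [|k].
      + rewrite get_0_pair. simpl. f_equal. lia.
      + rewrite get_S_pair, IH by lia. simpl Nat.eqb.
        destruct (k =? j); auto. f_equal. lia. }
  rewrite H by lia. destruct (i =? r); auto. f_equal. lia.
Qed.

Lemma pr_tri A : pr1 A tri.
Proof.
  apply (pr_iter A (fun _ => 0) (fun e => e 0) (fun k r _ => S k + r));
    [apply pr_zero| |apply pr_var].
  apply (pr_comp2 A Nat.add); [apply pr_add|apply pr_succ, pr_var|apply pr_var].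
Qed.

Lemma pr_pair A : pr2 A pair_nat.
Proof.
  apply (pr_comp2 A Nat.add); [apply pr_add| |apply pr_var].
  apply (pr_comp1 A tri); [apply pr_tri|apply pr_add].
Qed.

Lemma pr_diag A : pr1 A diag.
Proof.
  apply (pr_iter A (fun _ => 0) (fun e => e 0)
     (fun k r _ => if S k =? tri (S r) then S r else r));
    [apply pr_zero| |apply pr_var].
  apply pr_ite; [|apply pr_succ, pr_var|apply pr_var].
  apply prb_eqb; [apply pr_succ, pr_var|].
  apply (pr_comp1 A tri); [apply pr_tri|apply pr_succ, pr_var].
Qed.

Lemma pr_psnd A : pr1 A psnd.
Proof.
  apply (pr_comp2 A Nat.sub); [apply pr_sub|apply pr_var|].
  apply (pr_comp1 A tri); [apply pr_tri|apply pr_diag].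
Qed.

Lemma pr_pfst A : pr1 A pfst.
Proof.
  apply (pr_comp2 A Nat.sub); [apply pr_sub|apply pr_diag|apply pr_psnd].
Qed.

Lemma pr_drop A : pr2 A drop.
Proof.
  apply (pr_iter A (fun e => e 1) (fun e => e 0) (fun _ r _ => psnd r));
    [apply pr_var| |apply pr_var].
  apply (pr_comp1 A psnd); [apply pr_psnd|apply pr_var].
Qed.

Lemma pr_get A : pr2 A get.
Proof. apply (pr_comp1 A pfst); [apply pr_pfst|apply pr_drop]. Qed.

Ltac pr_solve :=
  match goal with
  | |- pr _ (fun e => e _) => apply pr_var
  | |- pr _ (fun e => S _) => apply pr_succ; pr_solve
  | |- pr _ (fun e => Nat.pred _) => apply (pr_comp1 _ Nat.pred); [apply pr_pred|pr_solve]
  | |- pr _ (fun e => Nat.add _ _) => apply (pr_comp2 _ Nat.add); [apply pr_add|pr_solve|pr_solve]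
  | |- pr _ (fun e => Nat.sub _ _) => apply (pr_comp2 _ Nat.sub); [apply pr_sub|pr_solve|pr_solve]
  | |- pr _ (fun e => pair_nat _ _) => apply (pr_comp2 _ pair_nat); [apply pr_pair|pr_solve|pr_solve]
  | |- pr _ (fun e => drop _ _) => apply (pr_comp2 _ drop); [apply pr_drop|pr_solve|pr_solve]
  | |- pr _ (fun e => get _ _) => apply (pr_comp2 _ get); [apply pr_get|pr_solve|pr_solve]
  | |- pr _ (fun e => pfst _) => apply (pr_comp1 _ pfst); [apply pr_pfst|pr_solve]
  | |- pr _ (fun e => psnd _) => apply (pr_comp1 _ psnd); [apply pr_psnd|pr_solve]
  | |- pr _ (fun e => if _ then _ else _) => apply pr_ite; pr_solve
  | |- pr _ (fun e => Nat.b2n _) =>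
      match goal with |- pr ?A (fun e => Nat.b2n (@?p e)) => change (prb A p); pr_solve end
  | |- prb _ (fun e => Nat.eqb _ _) => apply prb_eqb; pr_solve
  | |- prb _ (fun e => Nat.ltb _ _) => apply prb_ltb; pr_solve
  | |- prb _ (fun e => Nat.leb _ _) => apply prb_leb; pr_solve
  | |- prb _ (fun e => negb _) => apply prb_negb; pr_solve
  | |- prb _ (fun e => andb _ _) => apply prb_andb; pr_solve
  | |- prb _ (fun e => orb _ _) => apply prb_orb; pr_solve
  | |- prb _ (fun e => if _ then _ else _) => apply prb_ite; pr_solve
  | |- pr _ (fun e => ?c) => apply (pr_const _ c)
  | |- prb _ (fun e => ?c) => apply (prb_const _ c)
  | |- _ => idtac
  end.

Lemma pr_put A : pr3 A put.
Proof.
  apply (pr_iter A (fun e => pair_nat (e 2) (drop (S (e 1)) (e 0))) (fun e => e 1)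
    (fun j acc e => pair_nat (get (e 1 - S j) (e 0)) acc)); pr_solve.
Qed.

(** * A universal machine *)

(** Decoding is total, any tag above 1 meaning [Orc], so a search through all numbers is a search
    through all programs. *)
Definition decode_instr (w : nat) : instr :=
  match pfst w with
  | 0 => Inc (pfst (psnd w))
  | 1 => Dec (pfst (psnd w)) (psnd (psnd w))
  | _ => Orc (pfst (psnd w))
  end.

Definition decode_program (q : nat) : program :=
  map (fun i => decode_instr (get i (psnd q))) (seq 0 (pfst q)).

Definition encode_instr (i : instr) : nat :=
  match i with
  | Inc r => pair_nat 0 (pair_nat r 0)
  | Dec r j => pair_nat 1 (pair_nat r j)
  | Orc r => pair_nat 2 (pair_nat r 0)
  end.

Lemma decode_encode_instr i : decode_instr (encode_instr i) = i.
Proof.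
  unfold decode_instr.
  destruct i; simpl; rewrite ?psnd_pair, ?pfst_pair, ?psnd_pair; reflexivity.
Qed.

Lemma decode_program_surjective p : exists q, decode_program q = p.
Proof.
  assert (H : exists s, map (fun i => decode_instr (get i s)) (seq 0 (length p)) = p).
  { induction p as [|i p [s Hs]]; [now exists 0|].
    exists (pair_nat (encode_instr i) s). simpl.
    rewrite get_0_pair, decode_encode_instr. f_equal.
    rewrite <- seq_shift, map_map. rewrite <- Hs at 2.
    apply map_ext. intros j. now rewrite get_S_pair. }
  destruct H as [s Hs]. exists (pair_nat (length p) s).
  unfold decode_program. now rewrite pfst_pair, psnd_pair.
Qed.

Definition decode_config (c : nat) : config := (pfst c, fun i => get i (psnd c)).

Definition code_step (z : Cantor) (q c : nat) : nat :=
  let w := get (pfst c) (psnd q) in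
  let r := pfst (psnd w) in
  if pfst c <? pfst q then
    if pfst w =? 0 then pair_nat (S (pfst c)) (put (psnd c) r (S (get r (psnd c))))
    else if pfst w =? 1 then
      if get r (psnd c) =? 0 then pair_nat (psnd (psnd w)) (psnd c)
      else pair_nat (S (pfst c)) (put (psnd c) r (Nat.pred (get r (psnd c))))
    else pair_nat (S (pfst c)) (put (psnd c) r (Nat.b2n (z (get r (psnd c)))))
  else c.

Lemma decode_program_nth q i :
  nth_error (decode_program q) i =
  if i <? pfst q then Some (decode_instr (get i (psnd q))) else None.
Proof.
  unfold decode_program. rewrite nth_error_map.
  destruct (Nat.ltb_spec i (pfst q)) as [H|H].
  - rewrite nth_error_nth' with (d := 0) by now rewrite length_seq.
    now rewrite seq_nth.
  - rewrite (proj2 (nth_error_None _ _)); [reflexivity|now rewrite length_seq].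
Qed.

Lemma code_step_correct z q c :
  decode_config (code_step z q c) = step z (decode_program q) (decode_config c).
Proof.
  unfold step, decode_config at 2. rewrite decode_program_nth.
  unfold code_step. cbv zeta. destruct (pfst c <? pfst q); [|reflexivity].
  set (w := get (pfst c) (psnd q)). unfold decode_instr.
  destruct (pfst w) as [|[|n]]; simpl Nat.eqb; cbv iota.
  - unfold decode_config. rewrite pfst_pair, psnd_pair. f_equal.
    apply functional_extensionality; intro i. rewrite get_put. reflexivity.
  - destruct (get (pfst (psnd w)) (psnd c)) as [|v]; simpl Nat.eqb; cbv iota.
    + unfold decode_config. now rewrite pfst_pair, psnd_pair.
    + unfold decode_config. rewrite pfst_pair, psnd_pair. f_equal.
      apply functional_extensionality; intro i. rewrite get_put. reflexivity.
  - unfold decode_config. rewrite pfst_pair, psnd_pair. f_equal.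
    apply functional_extensionality; intro i. rewrite get_put. reflexivity.
Qed.

Definition code_run (z : Cantor) (q n t : nat) : nat :=
  nat_rect (fun _ => nat) (pair_nat 0 (put 0 0 n)) (fun _ c => code_step z q c) t.

(* [S v] if program [q] with oracle [z] halts on input [n] within [t] steps with
   output [v], and [0] if it is still running. *)
Definition univ (z : Cantor) (q n t : nat) : nat :=
  if pfst q <=? pfst (code_run z q n t)
  then S (get 0 (psnd (code_run z q n t))) else 0.

Lemma run_S A p k c : run A p (S k) c = step A p (run A p k c).
Proof. revert c; induction k; intros c; [reflexivity|]. simpl. simpl in IHk. now rewrite IHk. Qed.

Lemma code_run_correct z q n t :
  decode_config (code_run z q n t) = run z (decode_program q) t (init n).
Proof.
  induction t.
  - unfold code_run, decode_config, init; simpl.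
    rewrite pfst_pair, psnd_pair. f_equal.
    apply functional_extensionality; intro i. rewrite get_put, get_of_0. reflexivity.
  - rewrite run_S, <- IHt. apply code_step_correct.
Qed.

Lemma univ_halts z q n v :
  halts_with z (decode_program q) n v -> exists t, univ z q n t = S v.
Proof.
  intros [t [H1 H2]]. exists t. rewrite <- code_run_correct in H1, H2.
  unfold halted in H1. rewrite decode_program_nth in H1. simpl in H1, H2.
  unfold univ. rewrite H2.
  destruct (Nat.ltb_spec (pfst (code_run z q n t)) (pfst q)); [discriminate|].
  destruct (Nat.leb_spec (pfst q) (pfst (code_run z q n t))); [reflexivity|lia].
Qed.

Lemma univ_mono z q n v t t' : univ z q n t = S v -> t <= t' -> univ z q n t' = S v.
Proof.
  intros H Hle. induction Hle as [|t' Hle IH]; auto. revert IH. unfold univ.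
  destruct (Nat.leb_spec (pfst q) (pfst (code_run z q n t'))) as [Hh|Hh]; [|discriminate].
  intros E.
  assert (Es : code_run z q n (S t') = code_run z q n t').
  { change (code_run z q n (S t')) with (code_step z q (code_run z q n t')).
    unfold code_step; cbv zeta.
    destruct (Nat.ltb_spec (pfst (code_run z q n t')) (pfst q)); [lia|reflexivity]. }
  rewrite Es. destruct (Nat.leb_spec (pfst q) (pfst (code_run z q n t'))); [exact E|lia].
Qed.

Lemma pr_univ A z : turing_le z A -> pr3 A (univ z).
Proof.
  intros Hz.
  assert (Hstep : pr2 A (code_step z)).
  { red. unfold code_step; cbv zeta. pr_solve;
      (apply (pr_comp3 A put); [apply pr_put| | |]); pr_solve.
    apply prb_oracle; auto. pr_solve. }
  assert (Hrun : pr3 A (code_run z)).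
  { apply (pr_iter A (fun e => pair_nat 0 (put 0 0 (e 1))) (fun e => e 2)
      (fun _ c e => code_step z (e 0) c)); pr_solve.
    - apply (pr_comp3 A put); [apply pr_put| | |]; pr_solve.
    - apply (pr_comp2 A (code_step z)); pr_solve; assumption. }
  red. unfold univ. pr_solve; apply (pr_comp3 A (code_run z)); pr_solve; assumption.
Qed.

Lemma prb_even A f : pr A f -> prb A (fun e => Nat.even (f e)).
Proof.
  intros Hf.
  assert (H : pr A (fun e => nat_rect (fun _ => nat) 1 (fun _ r => 1 - r) (f e))).
  { apply (pr_iter A (fun _ => 1) f (fun _ r _ => 1 - r)); pr_solve. assumption. }
  red. match goal with |- pr A ?f2 => replace f2 with
    (fun e => nat_rect (fun _ => nat) 1 (fun _ r => 1 - r) (f e)); [exact H|] end.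
  apply functional_extensionality; intro e. induction (f e) as [|n IH]; [reflexivity|].
  rewrite Nat.even_succ, <- Nat.negb_even.
  transitivity (1 - Nat.b2n (Nat.even n)); [now rewrite <- IH|].
  now destruct (Nat.even n).
Qed.

Lemma pr_min A : pr2 A Nat.min.
Proof.
  red. replace (fun e : env => Nat.min (e 0) (e 1)) with
    (fun e : env => if e 0 <=? e 1 then e 0 else e 1); [pr_solve|].
  apply functional_extensionality; intro e. destruct (Nat.leb_spec (e 0) (e 1)); lia.
Qed.

Lemma pr_max A : pr2 A Nat.max.
Proof.
  red. replace (fun e : env => Nat.max (e 0) (e 1)) with
    (fun e : env => if e 0 <=? e 1 then e 1 else e 0); [pr_solve|].
  apply functional_extensionality; intro e. destruct (Nat.leb_spec (e 0) (e 1)); lia.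
Qed.

(** * Decoding *)

Definition computes (z : Cantor) (e : nat) (c : Cantor) : Prop :=
  forall i, exists t, univ z e i t = S (Nat.b2n (c i)).

(** Minimality makes the index unique, hence a possible target for a search starting at 0. *)
Definition least_index (z : Cantor) (e : nat) (c : Cantor) : Prop :=
  computes z e c /\ forall e', e' < e -> ~ computes z e' c.

Definition first_diff (c y : Cantor) (n : nat) : Prop :=
  (forall i, i < n -> y i = c i) /\ y n <> c n.

Definition agree_upto (z y : Cantor) (e m t : nat) : bool :=
  ball (fun i => univ z e i t =? S (Nat.b2n (y i))) m.

(** A guess at the least index of the real that [y] follows below [m]; [t] bounds both the programs
    tried and their running time. *)
Definition reindex (z y : Cantor) (m t : nat) : nat :=
  bmin (fun e => agree_upto z y e m t) t.

(** The search also stops where [univ] has not halted yet; [departed] tells this case from a true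
    disagreement. *)
Definition diff_search (z y : Cantor) (e T : nat) : nat :=
  bmin (fun n => negb (univ z e n T =? S (Nat.b2n (y n)))) T.

(* [S n] if the first difference [n] between [y] and the real computed by [e] from
   [z] is detected within time [T], and [0] otherwise. *)
Definition departed (z y : Cantor) (e T : nat) : nat :=
  if (diff_search z y e T <? T) && negb (univ z e (diff_search z y e T) T =? 0)
  then S (diff_search z y e T) else 0.

Lemma b2n_inj b b' : Nat.b2n b = Nat.b2n b' -> b = b'.
Proof. destruct b, b'; simpl; congruence. Qed.

Lemma univ_functional z e i t t' v v' : univ z e i t = S v -> univ z e i t' = S v' -> v = v'.
Proof.
  intros H H'. destruct (Nat.le_ge_cases t t') as [Hle|Hle].
  - rewrite (univ_mono _ _ _ _ _ _ H Hle) in H'. congruence.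
  - rewrite (univ_mono _ _ _ _ _ _ H' Hle) in H. congruence.
Qed.

Lemma eventually_below (P : nat -> nat -> Prop) n :
  (forall i, i < n -> exists t, forall t', t <= t' -> P i t') ->
  exists t, forall t', t <= t' -> forall i, i < n -> P i t'.
Proof.
  induction n as [|n IH]; intros H.
  - exists 0; intros; lia.
  - destruct IH as [t Ht]; [intros i Hi; apply H; lia|].
    destruct (H n) as [u Hu]; [lia|]. exists (t + u). intros t' Ht' i Hi.
    destruct (Nat.eq_dec i n) as [->|]; [apply Hu; lia|apply Ht; lia].
Qed.

Lemma computes_below z e c n :
  computes z e c ->
  exists t, forall t', t <= t' -> forall i, i < n -> univ z e i t' = S (Nat.b2n (c i)).
Proof.
  intros H. apply eventually_below. intros i _. destruct (H i) as [t Ht].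
  exists t. intros t' Hle. now apply univ_mono with t.
Qed.

(** Stopping before [n] on a halted computation would mean stopping at an agreement, and stopping
    after [n] would mean having accepted the disagreement there. Too small a [T] thus gives 0 and
    never a wrong level. *)
Lemma departed_sound z y e c n T :
  computes z e c -> first_diff c y n -> departed z y e T = 0 \/ departed z y e T = S n.
Proof.
  intros He [Hlt Hn]. unfold departed, diff_search.
  destruct (bmin_spec (fun n => negb (univ z e n T =? S (Nat.b2n (y n)))) T) as [_ [H2 H3]].
  set (d := bmin _ _) in *.
  destruct (Nat.ltb_spec d T) as [HT|HT]; simpl; auto.
  destruct (Nat.eqb_spec (univ z e d T) 0) as [|H0]; simpl; auto.
  right. f_equal. specialize (H3 HT).
  apply negb_true_iff, Nat.eqb_neq in H3.
  assert (Hval : forall i v, univ z e i T = S v -> v = Nat.b2n (c i)).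
  { intros i v E. destruct (He i) as [t Ht]. exact (univ_functional _ _ _ _ _ _ _ E Ht). }
  destruct (lt_eq_lt_dec d n) as [[H|H]|H]; auto; exfalso.
  - destruct (univ z e d T) as [|v] eqn:E; [lia|].
    apply H3. f_equal. rewrite Hlt by assumption. now apply Hval.
  - specialize (H2 n H). apply negb_false_iff, Nat.eqb_eq in H2.
    apply Hval, b2n_inj in H2. auto.
Qed.

Lemma departed_complete z y e c n :
  computes z e c -> first_diff c y n ->
  exists T0, forall T, T0 <= T -> departed z y e T = S n.
Proof.
  intros He [Hlt Hn]. destruct (computes_below z e c (S n) He) as [t Ht].
  exists (t + S n). intros T HT. unfold departed.
  assert (E : diff_search z y e T = n).
  { apply bmin_unique; [lia| |].
    - rewrite Ht by lia. apply negb_true_iff, Nat.eqb_neq.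
      intros E. injection E as E. apply b2n_inj in E. congruence.
    - intros k Hk. rewrite Ht, Hlt by lia. now rewrite Nat.eqb_refl. }
  rewrite E, Ht by lia. destruct (Nat.ltb_spec n T); [reflexivity|lia].
Qed.

(* Any smaller index eventually fails to produce an initial segment of [c]; once [m]
   exceeds the places where they fail, no smaller index can pass the test. *)
Lemma reindex_correct z e c :
  least_index z e c ->
  exists M, forall m, M <= m -> exists t0, forall t, t0 <= t ->
    forall y, (forall i, i < m -> y i = c i) -> reindex z y m t = e.
Proof.
  intros [He Hleast].
  destruct (eventually_below
    (fun e' m => exists i, i < m /\ forall t, univ z e' i t <> S (Nat.b2n (c i))) e) as [M HM].
  { intros e' He'. specialize (Hleast e' He').
    apply not_all_ex_not in Hleast. destruct Hleast as [i Hi].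
    exists (S i). intros m Hm. exists i. split; [lia|]. intros t Ht. apply Hi; eauto. }
  exists M. intros m Hm. destruct (computes_below z e c m He) as [t0 Ht0].
  exists (t0 + S e). intros t Ht y Hy. apply bmin_unique; [lia| |].
  - apply ball_true. intros i Hi. rewrite Ht0, Hy by lia. apply Nat.eqb_refl.
  - intros e' He'. apply not_true_is_false. intros H.
    unfold agree_upto in H. rewrite ball_true in H.
    destruct (HM m Hm e' He') as [i [Hi Hne]]. specialize (H i Hi).
    apply Nat.eqb_eq in H. rewrite Hy in H by assumption. exact (Hne _ H).
Qed.

(** * The decoder and its primitive recursiveness *)

Section Decoder.
Variables (z : Cantor) (YA YB : bool -> Cantor) (e0 : nat).

(** A state [r] is 0 for failure, or the successor of the pair of indices followed by the two reals
    of the group [Nat.even k], whose turn it is at stage [k]. *)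
Definition dep_A (T k r : nat) : nat := departed z (YA (Nat.even k)) (pfst (Nat.pred r)) T.
Definition dep_B (T k r : nat) : nat := departed z (YB (Nat.even k)) (psnd (Nat.pred r)) T.

(** Whichever real departs first, the smaller departure is the length and the larger one the time
    bound for identifying what the other group follows. *)
Definition decode_step (T k r : nat) : nat :=
  if (r =? 0) || (dep_A T k r =? 0) || (dep_B T k r =? 0) then 0 else
  S (pair_nat
       (reindex z (YA (Nat.even (S k))) (Nat.min (dep_A T k r) (dep_B T k r))
                                        (Nat.max (dep_A T k r) (dep_B T k r)))
       (reindex z (YB (Nat.even (S k))) (Nat.min (dep_A T k r) (dep_B T k r))
                                        (Nat.max (dep_A T k r) (dep_B T k r)))).

Definition decode_state (T k : nat) : nat :=
  nat_rect (fun _ => nat) (S (pair_nat e0 e0)) (fun k r => decode_step T k r) k.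

Definition decode_bit (T k : nat) : nat :=
  let r := decode_state T k in
  if (r =? 0) || (dep_A T k r =? 0) || (dep_B T k r =? 0) then 0
  else S (Nat.b2n (dep_A T k r <? dep_B T k r)).

Variables (A : Cantor) (Hz : turing_le z A).

Lemma pr_univ_comp f g h : pr A f -> pr A g -> pr A h ->
  pr A (fun e => univ z (f e) (g e) (h e)).
Proof. intros. apply (pr_comp3 A (univ z)); auto. now apply pr_univ. Qed.

Lemma prb_select (Y : bool -> Cantor) f g :
  (forall b, turing_le (Y b) A) -> pr A f -> pr A g ->
  prb A (fun e => Y (Nat.even (f e)) (g e)).
Proof.
  intros HY Hf Hg.
  replace (fun e => Y (Nat.even (f e)) (g e)) with
    (fun e => if Nat.even (f e) then Y true (g e) else Y false (g e)).
  - apply prb_ite; [now apply prb_even| |]; apply prb_oracle; auto.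
  - apply functional_extensionality; intro e. now destruct (Nat.even (f e)).
Qed.

Lemma pr_diff_search (Y : bool -> Cantor) :
  (forall b, turing_le (Y b) A) ->
  pr3 A (fun k e T => diff_search z (Y (Nat.even k)) e T).
Proof.
  intros HY. red. unfold diff_search.
  apply (pr_bmin A (fun n e => negb (univ z (e 1) n (e 2) =? S (Nat.b2n (Y (Nat.even (e 0)) n)))));
    pr_solve.
  - apply pr_univ_comp; pr_solve.
  - apply prb_select; auto; pr_solve.
Qed.

Lemma pr_departed (Y : bool -> Cantor) :
  (forall b, turing_le (Y b) A) ->
  pr3 A (fun k e T => departed z (Y (Nat.even k)) e T).
Proof.
  intros HY. pose proof (pr_diff_search Y HY) as H. red in H. red. unfold departed. pr_solve; auto.
  apply pr_univ_comp; pr_solve; auto.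
Qed.

Lemma pr_reindex (Y : bool -> Cantor) :
  (forall b, turing_le (Y b) A) ->
  pr3 A (fun k m t => reindex z (Y (Nat.even k)) m t).
Proof.
  intros HY. red. unfold reindex.
  apply (pr_bmin A (fun n e => agree_upto z (Y (Nat.even (e 0))) n (e 1) (e 2))); pr_solve.
  unfold agree_upto.
  apply (prb_ball A (fun i e =>
     univ z (e 0) i (e 3) =? S (Nat.b2n (Y (Nat.even (e 1)) i)))); pr_solve.
  - apply pr_univ_comp; pr_solve.
  - apply prb_select; auto; pr_solve.
Qed.

Lemma pr_decode_bit :
  (forall b, turing_le (YA b) A) -> (forall b, turing_le (YB b) A) ->
  pr2 A decode_bit.
Proof.
  intros HA HB.
  assert (dA : pr3 A dep_A).
  { apply (pr_comp3 A (fun k e T => departed z (YA (Nat.even k)) e T));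
      [now apply pr_departed| | |]; pr_solve. }
  assert (dB : pr3 A dep_B).
  { apply (pr_comp3 A (fun k e T => departed z (YB (Nat.even k)) e T));
      [now apply pr_departed| | |]; pr_solve. }
  assert (Hst : pr2 A decode_state).
  { apply (pr_iter A (fun _ => S (pair_nat e0 e0)) (fun e => e 1)
       (fun k r e => decode_step (e 0) k r)); [pr_solve| |pr_solve].
    apply (pr_comp3 A decode_step); pr_solve. red. unfold decode_step.
    pr_solve; auto.
    - apply (pr_comp3 A (fun k m t => reindex z (YA (Nat.even k)) m t));
        [now apply pr_reindex|pr_solve| |].
      + apply (pr_comp2 A Nat.min); auto using pr_min.
      + apply (pr_comp2 A Nat.max); auto using pr_max.
    - apply (pr_comp3 A (fun k m t => reindex z (YB (Nat.even k)) m t));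
        [now apply pr_reindex|pr_solve| |].
      + apply (pr_comp2 A Nat.min); auto using pr_min.
      + apply (pr_comp2 A Nat.max); auto using pr_max. }
  red. unfold decode_bit; cbv zeta.
  assert (dA' : pr A (fun e => dep_A (e 0) (e 1) (decode_state (e 0) (e 1)))).
  { apply (pr_comp3 A dep_A); pr_solve; auto. }
  assert (dB' : pr A (fun e => dep_B (e 0) (e 1) (decode_state (e 0) (e 1)))).
  { apply (pr_comp3 A dep_B); pr_solve; auto. }
  pr_solve; auto.
Qed.

End Decoder.

(** * Coding into the range of a continuous injection *)

Definition zeros (s : list bool) : Cantor := fun n => nth n s false.
Definition prefix (s : list bool) (x : Cantor) : Prop :=
  forall i, i < length s -> x i = zeros s i.
Definition restrict (c : Cantor) (l : nat) : list bool := map c (seq 0 l).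

Lemma restrict_length c l : length (restrict c l) = l.
Proof. unfold restrict. now rewrite length_map, length_seq. Qed.

Lemma zeros_restrict c l i : i < l -> zeros (restrict c l) i = c i.
Proof.
  intros Hi. unfold zeros, restrict.
  rewrite nth_indep with (d' := c 0) by now rewrite length_map, length_seq.
  now rewrite map_nth, seq_nth.
Qed.

Lemma zeros_beyond s i : length s <= i -> zeros s i = false.
Proof. apply nth_overflow. Qed.

Lemma zeros_restrict_zeros s l : length s <= l -> zeros (restrict (zeros s) l) = zeros s.
Proof.
  intros Hl. apply functional_extensionality; intro i.
  destruct (Nat.lt_ge_cases i l) as [Hi|Hi]; [now apply zeros_restrict|].
  rewrite !zeros_beyond; [reflexivity|lia|now rewrite restrict_length].
Qed.

Definition extends (s s' : list bool) : Prop :=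
  length s < length s' /\ prefix s (zeros s').

Definition continuous_cantor (F : Cantor -> Cantor) : Prop :=
  forall x m, exists n, forall x', (forall i, i < n -> x' i = x i) ->
    forall i, i < m -> F x' i = F x i.

Section Coding.
Variable F : Cantor -> Cantor.
Hypothesis F_cont : continuous_cantor F.
Hypothesis F_inj : forall x x', F x = F x' -> x = x'.
Variable z : Cantor.
Hypothesis z_computes : forall s, turing_le (F (zeros s)) z.

Lemma least_index_exists s : exists e, least_index z e (F (zeros s)).
Proof.
  assert (H : exists e, computes z e (F (zeros s))).
  { destruct (z_computes s) as [p Hp]. destruct (decode_program_surjective p) as [q <-].
    exists q. intros i. apply univ_halts, Hp. }
  destruct H as [e He]. revert He. induction e as [e IH] using lt_wf_ind. intros He.
  destruct (classic (exists e', e' < e /\ computes z e' (F (zeros s)))) as [[e' [H1 H2]]|H].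
  - now apply (IH e').
  - exists e. split; auto. intros e' He' Hc. apply H; eauto.
Qed.

Lemma first_diff_exists (c y : Cantor) : c <> y -> exists n, first_diff c y n.
Proof.
  intros Hne. assert (H : exists n, y n <> c n).
  { apply NNPP. intros H. apply Hne. apply functional_extensionality; intro n.
    symmetry. apply NNPP. intros Hn. apply H; eauto. }
  destruct H as [n Hn]. revert Hn. induction n as [n IH] using lt_wf_ind. intros Hn.
  destruct (classic (exists i, i < n /\ y i <> c i)) as [[i [H1 H2]]|H].
  - now apply (IH i).
  - exists n. split; auto. intros i Hi. apply NNPP. intros Hd. apply H; eauto.
Qed.

(** Raising one late bit of [zeros s] keeps the first [M] bits of the image by continuity and
    changes the image by injectivity; continuity at the new argument preserves the change on a whole
    cylinder. *)
Lemma depart s M : exists s' n, M <= n /\ extends s s' /\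
  forall x, prefix s' x -> first_diff (F (zeros s)) (F x) n.
Proof.
  destruct (F_cont (zeros s) M) as [N HN].
  set (r := N + length s).
  set (c := fun i => if i =? r then true else zeros s i).
  assert (Hc : forall i, i < r -> c i = zeros s i).
  { intros i Hi. unfold c. destruct (Nat.eqb_spec i r); [lia|reflexivity]. }
  destruct (first_diff_exists (F (zeros s)) (F c)) as [n [Hn1 Hn2]].
  { intros E. apply F_inj in E. assert (E' := f_equal (fun g => g r) E). simpl in E'.
    unfold c in E'. rewrite Nat.eqb_refl, zeros_beyond in E'; [discriminate|lia]. }
  destruct (F_cont c (S n)) as [N' HN'].
  exists (restrict c (S (N' + r))), n. split; [|split; [split|]].
  - destruct (Nat.le_gt_cases M n) as [|Hlt]; auto. exfalso. apply Hn2, HN; auto.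
    intros i Hi. apply Hc; unfold r; lia.
  - rewrite restrict_length; lia.
  - intros i Hi. rewrite zeros_restrict by lia. apply Hc; lia.
  - intros x Hx. assert (Hx' : forall i, i < S n -> F x i = F c i).
    { apply HN'. intros i Hi. rewrite Hx by (rewrite restrict_length; lia).
      apply zeros_restrict; lia. }
    split; [intros i Hi|]; rewrite Hx' by lia; auto.
Qed.

(** [sa] and [sb] belong to the resting group and grow by zeros only; [sc] and [sd] belong to the
    departing one. [S n1] and [S n2] are the values that [departed] returns. *)
Definition half_step (sa sb sc sd sa' sb' sc' sd' : list bool) (n1 n2 : nat) : Prop :=
  extends sa sa' /\ extends sb sb' /\ extends sc sc' /\ extends sd sd' /\
  zeros sa' = zeros sa /\ zeros sb' = zeros sb /\
  (forall x, prefix sc' x -> first_diff (F (zeros sc)) (F x) n1) /\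
  (forall x, prefix sd' x -> first_diff (F (zeros sd)) (F x) n2) /\
  (forall e x, least_index z e (F (zeros sa)) -> prefix sa' x ->
     reindex z (F x) (Nat.min (S n1) (S n2)) (Nat.max (S n1) (S n2)) = e) /\
  (forall e x, least_index z e (F (zeros sb)) -> prefix sb' x ->
     reindex z (F x) (Nat.min (S n1) (S n2)) (Nat.max (S n1) (S n2)) = e).

Lemma least_index_unique e e' c : least_index z e c -> least_index z e' c -> e = e'.
Proof.
  intros [H1 H2] [H1' H2']. destruct (lt_eq_lt_dec e e') as [[H|H]|H]; auto; exfalso.
  - exact (H2' e H H1).
  - exact (H2 e' H H1').
Qed.

(** Appending zeros until continuity fixes the first [m] bits makes [reindex_correct] apply. The
    quantifier order shapes the coding: the time bound is known only after [m], so a second, later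
    departure has to carry it. *)
Lemma reindex_at s : exists M, forall m, M <= m -> exists t0 s',
  extends s s' /\ zeros s' = zeros s /\
  forall t e x, t0 <= t -> least_index z e (F (zeros s)) -> prefix s' x ->
    reindex z (F x) m t = e.
Proof.
  destruct (least_index_exists s) as [e He].
  destruct (reindex_correct z e _ He) as [M HM]. exists M. intros m Hm.
  destruct (HM m Hm) as [t0 Ht0]. destruct (F_cont (zeros s) m) as [N HN].
  exists t0, (restrict (zeros s) (S (length s) + N)). split; [split|split].
  - rewrite restrict_length; lia.
  - intros i Hi. apply zeros_restrict; lia.
  - apply zeros_restrict_zeros; lia.
  - intros t e' x Ht He' Hx. rewrite (least_index_unique e' e _ He' He).
    apply Ht0; auto. apply HN. intros i Hi.
    rewrite Hx by (rewrite restrict_length; lia). apply zeros_restrict; lia.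
Qed.

Lemma half_step_lt sa sb sc sd :
  exists sa' sb' sc' sd' n1 n2, half_step sa sb sc sd sa' sb' sc' sd' n1 n2 /\ n1 < n2.
Proof.
  destruct (reindex_at sa) as [Ma HMa]. destruct (reindex_at sb) as [Mb HMb].
  destruct (depart sc (Ma + Mb)) as [sc' [n1 [Hn1 [Hc Hdc]]]].
  destruct (HMa (S n1)) as [ta [sa' [Ha [Hza Hra]]]]; [lia|].
  destruct (HMb (S n1)) as [tb [sb' [Hb [Hzb Hrb]]]]; [lia|].
  destruct (depart sd (ta + tb + S n1)) as [sd' [n2 [Hn2 [Hd Hdd]]]].
  exists sa', sb', sc', sd', n1, n2. split; [|lia].
  unfold half_step. rewrite Nat.min_l, Nat.max_r by lia.
  repeat (split; [assumption|]). split.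
  - intros e x. apply Hra. lia.
  - intros e x. apply Hrb. lia.
Qed.

(** Exchanging the roles of [sc] and [sd] reverses the order of the departures. *)
Lemma half_step_bit sa sb sc sd bit :
  exists sa' sb' sc' sd' n1 n2,
    half_step sa sb sc sd sa' sb' sc' sd' n1 n2 /\ (S n1 <? S n2) = bit.
Proof.
  destruct bit.
  - destruct (half_step_lt sa sb sc sd) as (sa' & sb' & sc' & sd' & n1 & n2 & H & Hlt).
    exists sa', sb', sc', sd', n1, n2. split; auto. apply Nat.ltb_lt; lia.
  - destruct (half_step_lt sa sb sd sc) as (sa' & sb' & sd' & sc' & n2 & n1 & H & Hlt).
    exists sa', sb', sc', sd', n1, n2. split; [|apply Nat.ltb_ge; lia].
    unfold half_step in *. rewrite (Nat.min_comm (S n1)), (Nat.max_comm (S n1)). tauto.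
Qed.

(** * Building the four reals in stages *)

Record stage : Type := { strA : bool -> list bool; strB : bool -> list bool;
                         depA : nat; depB : nat }.

(** Group [p] departs while group [negb p] rests and has its indices revealed, ready for its own
    departure at the next stage. *)
Definition stage_step (x : Cantor) (k : nat) (s s' : stage) : Prop :=
  let p := Nat.even k in
  half_step (strA s (negb p)) (strB s (negb p)) (strA s p) (strB s p)
            (strA s' (negb p)) (strB s' (negb p)) (strA s' p) (strB s' p)
            (depA s') (depB s') /\
  (S (depA s') <? S (depB s')) = x k.

Lemma stage_step_exists x k s : exists s', stage_step x k s s'.
Proof.
  set (p := Nat.even k).
  destruct (half_step_bit (strA s (negb p)) (strB s (negb p)) (strA s p) (strB s p) (x k))
    as (sa' & sb' & sc' & sd' & n1 & n2 & H & Hbit).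
  exists {| strA := fun g => if eqb g p then sc' else sa';
            strB := fun g => if eqb g p then sd' else sb';
            depA := n1; depB := n2 |}.
  split; auto. cbn [strA strB depA depB]. fold p. destruct p; exact H.
Qed.

Lemma stages_exist x : exists st : nat -> stage,
  (forall g, strA (st 0) g = []) /\ (forall g, strB (st 0) g = []) /\
  forall k, stage_step x k (st k) (st (S k)).
Proof.
  set (next := fun k s => proj1_sig
    (constructive_indefinite_description _ (stage_step_exists x k s))).
  exists (nat_rect (fun _ => stage)
    {| strA := fun _ => []; strB := fun _ => []; depA := 0; depB := 0 |} next).
  split; [reflexivity|split; [reflexivity|]]. intros k. simpl. unfold next at 1.
  apply proj2_sig.
Qed.

(** Lengths grow strictly, so [s (S n)] has more than [n] bits and bit [n] of the limit can be read
    there. *)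
Lemma limit_of_strings (s : nat -> list bool) :
  (forall k, extends (s k) (s (S k))) -> exists x, forall k, prefix (s k) x.
Proof.
  intros H.
  assert (Hlen : forall k, k <= length (s k)).
  { induction k; [lia|]. destruct (H k). lia. }
  assert (Hmono : forall j k, j <= k ->
     length (s j) <= length (s k) /\ prefix (s j) (zeros (s k))).
  { induction 1 as [|k Hle [IH1 IH2]]; [split; [lia|intros i _; reflexivity]|].
    destruct (H k) as [H1 H2]. split; [lia|]. intros i Hi. rewrite H2 by lia. now apply IH2. }
  exists (fun n => zeros (s (S n)) n). intros k i Hi. simpl.
  destruct (Nat.le_ge_cases k (S i)) as [Hle|Hle].
  - now apply Hmono.
  - symmetry. apply (proj2 (Hmono _ _ Hle)). specialize (Hlen (S i)). lia.
Qed.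

(* Two groups of two reals take turns.  A real whose string is [s] follows
   [F (zeros s)]; when its group is on, it departs from it, the order of the two
   departures transmits one bit of [x], and the two departure levels [m < t] let
   the decoder find the indices of the reals that the other group is following. *)
Theorem coding_four_reals x : exists xA xB : bool -> Cantor,
  forall A, turing_le z A ->
    (forall g, turing_le (F (xA g)) A) -> (forall g, turing_le (F (xB g)) A) ->
    turing_le x A.
Proof.
  destruct (stages_exist x) as [st [HA0 [HB0 Hst]]].
  assert (HextA : forall g k, extends (strA (st k) g) (strA (st (S k)) g)).
  { intros g k. destruct (Hst k) as [(? & ? & ? & ? & _) _].
    destruct g, (Nat.even k); assumption. }
  assert (HextB : forall g k, extends (strB (st k) g) (strB (st (S k)) g)).
  { intros g k. destruct (Hst k) as [(? & ? & ? & ? & _) _].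
    destruct g, (Nat.even k); assumption. }
  set (lim := fun s H => proj1_sig
    (constructive_indefinite_description _ (limit_of_strings s H))).
  set (xA := fun g => lim _ (HextA g)). set (xB := fun g => lim _ (HextB g)).
  assert (HxA : forall g k, prefix (strA (st k) g) (xA g)).
  { intros g. unfold xA, lim.
    apply (proj2_sig (constructive_indefinite_description _ (limit_of_strings _ (HextA g)))). }
  assert (HxB : forall g k, prefix (strB (st k) g) (xB g)).
  { intros g. unfold xB, lim.
    apply (proj2_sig (constructive_indefinite_description _ (limit_of_strings _ (HextB g)))). }
  exists xA, xB. intros A Hz HA HB.
  set (ix := fun s => proj1_sig
    (constructive_indefinite_description _ (least_index_exists s))).
  assert (Hix : forall s, least_index z (ix s) (F (zeros s))).
  { intros s. unfold ix. apply proj2_sig. }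
  set (YA := fun g => F (xA g)). set (YB := fun g => F (xB g)).
  set (D := decode_state z YA YB (ix [])).
  (* The state the decoder should reach at stage [k]: the true indices for the group about to
     depart. *)
  set (good := fun k => S (pair_nat (ix (strA (st k) (Nat.even k)))
                                    (ix (strB (st k) (Nat.even k))))).
  assert (HdA : forall k T, let d := dep_A z YA T k (good k) in
            d = 0 \/ d = S (depA (st (S k)))).
  { intros k T. unfold dep_A, good. cbv zeta. simpl Nat.pred. rewrite pfst_pair.
    apply departed_sound with (c := F (zeros (strA (st k) (Nat.even k)))); [apply Hix|].
    destruct (Hst k) as [(_ & _ & _ & _ & _ & _ & H & _) _]. apply H, HxA. }
  assert (HdB : forall k T, let d := dep_B z YB T k (good k) in
            d = 0 \/ d = S (depB (st (S k)))).
  { intros k T. unfold dep_B, good. cbv zeta. simpl Nat.pred. rewrite psnd_pair.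
    apply departed_sound with (c := F (zeros (strB (st k) (Nat.even k)))); [apply Hix|].
    destruct (Hst k) as [(_ & _ & _ & _ & _ & _ & _ & H & _) _]. apply H, HxB. }
  assert (HdA' : forall k, exists T0, forall T, T0 <= T ->
            dep_A z YA T k (good k) = S (depA (st (S k)))).
  { intros k. unfold dep_A, good. simpl Nat.pred. rewrite pfst_pair.
    apply departed_complete with (c := F (zeros (strA (st k) (Nat.even k)))); [apply Hix|].
    destruct (Hst k) as [(_ & _ & _ & _ & _ & _ & H & _) _]. apply H, HxA. }
  assert (HdB' : forall k, exists T0, forall T, T0 <= T ->
            dep_B z YB T k (good k) = S (depB (st (S k)))).
  { intros k. unfold dep_B, good. simpl Nat.pred. rewrite psnd_pair.
    apply departed_complete with (c := F (zeros (strB (st k) (Nat.even k)))); [apply Hix|].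
    destruct (Hst k) as [(_ & _ & _ & _ & _ & _ & _ & H & _) _]. apply H, HxB. }
  assert (Hnext : forall k T,
      dep_A z YA T k (good k) = S (depA (st (S k))) ->
      dep_B z YB T k (good k) = S (depB (st (S k))) ->
      decode_step z YA YB T k (good k) = good (S k)).
  { intros k T EA EB. unfold decode_step. rewrite EA, EB.
    change (good k =? 0) with false. cbv [orb Nat.eqb].
    rewrite Nat.even_succ, <- Nat.negb_even. unfold good.
    rewrite Nat.even_succ, <- Nat.negb_even.
    destruct (Hst k) as [(_ & _ & _ & _ & Hza & Hzb & _ & _ & Hra & Hrb) _].
    f_equal. f_equal.
    (* The resting strings grew by zeros only, so the index recovered now is still the one followed
       at stage [S k]. *)
    - apply Hra; [rewrite <- Hza; apply Hix|apply HxA].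
    - apply Hrb; [rewrite <- Hzb; apply Hix|apply HxB]. }
  (* Too small a [T] leads to state 0 and never to wrong indices, so any answer found by the search
     can be trusted. *)
  assert (Hsound : forall k T, D T k = 0 \/ D T k = good k).
  { induction k as [|k IH]; intros T.
    - right. unfold D, good. cbn [decode_state nat_rect]. now rewrite HA0, HB0.
    - change (D T (S k)) with (decode_step z YA YB T k (D T k)).
      destruct (IH T) as [->| ->]; [now left|].
      destruct (HdA k T) as [EA|EA]; [left|destruct (HdB k T) as [EB|EB]; [left|right]].
      + unfold decode_step. now rewrite EA.
      + unfold decode_step. now rewrite EB, EA.
      + now apply Hnext. }
  assert (Hcomplete : forall k, exists T0, forall T, T0 <= T -> D T k = good k).
  { induction k as [|k [T0 IH]].
    - exists 0. intros T _. unfold D, good. cbn [decode_state nat_rect]. now rewrite HA0, HB0.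
    - destruct (HdA' k) as [TA HTA]. destruct (HdB' k) as [TB HTB].
      exists (T0 + TA + TB). intros T HT.
      change (D T (S k)) with (decode_step z YA YB T k (D T k)).
      rewrite IH by lia. apply Hnext; [apply HTA|apply HTB]; lia. }
  assert (Hbit : forall k T, D T k = good k ->
      dep_A z YA T k (good k) = S (depA (st (S k))) ->
      dep_B z YB T k (good k) = S (depB (st (S k))) ->
      decode_bit z YA YB (ix []) T k = S (Nat.b2n (x k))).
  { intros k T E EA EB. unfold decode_bit. cbv zeta. fold D. rewrite E, EA, EB.
    change (good k =? 0) with false. cbv [orb]. simpl Nat.eqb. cbv iota.
    destruct (Hst k) as [_ ->]. reflexivity. }
  apply turing_le_search with (h := fun e => decode_bit z YA YB (ix []) (e 0) (e 1)).
  - now apply pr_decode_bit.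
  - intros n. destruct (Hcomplete n) as [T0 H0].
    destruct (HdA' n) as [TA HTA]. destruct (HdB' n) as [TB HTB].
    exists (T0 + TA + TB). simpl. rewrite Hbit; [discriminate|apply H0|apply HTA|apply HTB]; lia.
  - intros n T. simpl. intros H. revert H.
    destruct (Hsound n T) as [E|E].
    + unfold decode_bit. cbv zeta. fold D. rewrite E. intros H. now destruct H.
    + destruct (HdA n T) as [EA|EA].
      { unfold decode_bit. cbv zeta. fold D. rewrite E, EA. intros H.
        now destruct H. }
      destruct (HdB n T) as [EB|EB].
      { unfold decode_bit. cbv zeta. fold D. rewrite E, EA, EB. intros H.
        now destruct H. }
      intros _. now apply Hbit.
Qed.

End Coding.

(** * Borel functions are continuous on a perfect set *)

Definition agree (m : nat) (x y : Cantor) : Prop := forall i, i < m -> y i = x i.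

Definition dense_open (D : Cantor -> Prop) : Prop :=
  (forall x, D x -> exists m, forall y, agree m x y -> D y) /\
  (forall s, exists x, prefix s x /\ D x).

Definition decides (G B : Cantor -> Prop) : Prop :=
  forall x, G x -> exists m, forall y, G y -> agree m x y -> (B y <-> B x).

(* [B] is relatively clopen on a dense G_delta set, a form of the Baire property. *)
Definition clopen_on_comeager (B : Cantor -> Prop) : Prop :=
  exists D : nat -> Cantor -> Prop,
    (forall n, dense_open (D n)) /\ decides (fun x => forall n, D n x) B.

Lemma clopen_on_comeager_countable (B : nat -> Cantor -> Prop) :
  (forall n, clopen_on_comeager (B n)) ->
  exists D : nat -> Cantor -> Prop, (forall n, dense_open (D n)) /\
    forall n, decides (fun x => forall k, D k x) (B n).
Proof.
  intros H.
  set (E := fun n => proj1_sig (constructive_indefinite_description _ (H n))).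
  assert (HE : forall n, (forall k, dense_open (E n k)) /\
                         decides (fun x => forall k, E n k x) (B n)).
  { intros n. unfold E. apply proj2_sig. }
  exists (fun k => E (pfst k) (psnd k)). split.
  - intros k. apply HE.
  - assert (Hsub : forall n x, (forall k, E (pfst k) (psnd k) x) -> forall k, E n k x).
    { intros n x Hx k. specialize (Hx (pair_nat n k)). now rewrite pfst_pair, psnd_pair in Hx. }
    intros n x Hx. destruct (proj2 (HE n) x (Hsub n x Hx)) as [m Hm].
    exists m. intros y Hy. apply Hm. now apply Hsub.
Qed.

(** For a union, [U] collects the points with a neighbourhood on which membership is constant over
    [G]. It is dense: a cylinder either contains a point of [G] in some [B n], around which [B n] is
    decided, or contains none and is itself such a neighbourhood. *)
Lemma borel_clopen_on_comeager B : borel B -> clopen_on_comeager B.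
Proof.
  induction 1 as [B [n [b HB]]|B _ [D [HD HB]]|B _ IH|B B' _ [D [HD HB]] Heq].
  - exists (fun _ _ => True). split.
    + intros _. split; [now exists 0|]. intros s. exists (zeros s). split; auto.
      intros i _; reflexivity.
    + intros x _. exists (S n). intros y _ Hxy. rewrite !HB, Hxy by lia. reflexivity.
  - exists D. split; auto. intros x Hx. destruct (HB x Hx) as [m Hm].
    exists m. intros y Hy Hxy. specialize (Hm y Hy Hxy). tauto.
  - destruct (clopen_on_comeager_countable B IH) as [D [HD HB]].
    set (G := fun x => forall k, D k x) in *.
    set (U := fun x => exists m, (forall y, G y -> agree m x y -> exists n, B n y) \/
                                 (forall y, G y -> agree m x y -> ~ exists n, B n y)).
    exists (fun k => match k with 0 => U | S k => D k end). split.
    + intros [|k]; [|apply HD]. split.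
      * intros x [m Hm]. exists m. intros y Hxy. exists m.
        destruct Hm as [Hm|Hm]; [left|right]; intros w Hw Hyw; apply Hm; auto;
          intros i Hi; rewrite Hyw by assumption; now apply Hxy.
      * intros s. destruct (classic (exists x, prefix s x /\ G x /\ exists n, B n x))
          as [[x [Hs [Hx [n Hn]]]]|Hno].
        -- exists x. split; auto. destruct (HB n x Hx) as [m Hm]. exists m. left.
           intros y Hy Hxy. exists n. now apply Hm.
        -- exists (zeros s). split; [intros i _; reflexivity|]. exists (length s). right.
           intros y Hy Hsy Hex. apply Hno. exists y. auto.
    + intros x Hx. destruct (Hx 0) as [m Hm]. exists m. intros y Hy Hxy.
      assert (Gx : G x) by (intros k; exact (Hx (S k))).
      assert (Gy : G y) by (intros k; exact (Hy (S k))).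
      assert (Hxx : agree m x x) by (intros i _; reflexivity).
      destruct Hm as [Hm|Hm]; pose proof (Hm y Gy Hxy); pose proof (Hm x Gx Hxx); tauto.
  - exists D. split; auto. intros x Hx. destruct (HB x Hx) as [m Hm].
    exists m. intros y Hy Hxy. rewrite <- !Heq. auto.
Qed.

Lemma dense_open_extension D s : dense_open D ->
  exists s', extends s s' /\ forall x, prefix s' x -> D x.
Proof.
  intros [Hopen Hdense]. destruct (Hdense s) as [x [Hs Hx]].
  destruct (Hopen x Hx) as [m Hm].
  exists (restrict x (m + S (length s))). split; [split|].
  - rewrite restrict_length; lia.
  - intros i Hi. rewrite zeros_restrict by lia. now apply Hs.
  - intros y Hy. apply Hm. intros i Hi. rewrite Hy by (rewrite restrict_length; lia).
    apply zeros_restrict; lia.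
Qed.

Lemma zeros_app_l s t i : i < length s -> zeros (s ++ t) i = zeros s i.
Proof. intros Hi. now apply app_nth1. Qed.

Lemma zeros_app_last s b : zeros (s ++ [b]) (length s) = b.
Proof. unfold zeros. rewrite app_nth2, Nat.sub_diag; [reflexivity|lia]. Qed.

(** A fusion argument: stage [k] appends the bit [x k] and then extends into [D k]. The appended
    bits can be read back one after another, whence injectivity. *)
Lemma perfect_set_in_comeager (D : nat -> Cantor -> Prop) (root : list bool) :
  (forall n, dense_open (D n)) ->
  exists phi : Cantor -> Cantor,
    (forall x, prefix root (phi x)) /\ (forall x n, D n (phi x)) /\
    (forall x x', phi x = phi x' -> x = x') /\
    (forall x x' n, agree n x x' -> agree n (phi x) (phi x')).
Proof.
  intros HD.
  set (next := fun n s => proj1_sig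
    (constructive_indefinite_description _ (dense_open_extension (D n) s (HD n)))).
  assert (Hnext : forall n s, extends s (next n s) /\ forall x, prefix (next n s) x -> D n x).
  { intros n s. unfold next. apply proj2_sig. }
  set (str := fun x : Cantor => nat_rect (fun _ => list bool) root
                       (fun k s => next k (s ++ [x k]))).
  assert (Hstep : forall x k, extends (str x k ++ [x k]) (str x (S k))) by (intros; apply Hnext).
  assert (Hext : forall x k, extends (str x k) (str x (S k))).
  { intros x k. destruct (Hstep x k) as [H1 H2]. rewrite length_app in H1; cbn [length] in H1.
    split; [lia|]. intros i Hi. rewrite H2 by (rewrite length_app; simpl; lia).
    now apply zeros_app_l. }
  assert (Hlen : forall x k, k <= length (str x k)).
  { intros x. induction k; [lia|]. destruct (Hext x k). lia. }
  set (phi := fun x => proj1_sig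
    (constructive_indefinite_description _ (limit_of_strings (str x) (Hext x)))).
  assert (Hphi : forall x k, prefix (str x k) (phi x)).
  { intros x. unfold phi. apply proj2_sig. }
  assert (Hbranch : forall x k, phi x (length (str x k)) = x k).
  { intros x k. destruct (Hstep x k) as [H1 H2]. rewrite length_app in H1; cbn [length] in H1.
    rewrite (Hphi x (S k)) by lia. rewrite H2 by (rewrite length_app; simpl; lia).
    apply zeros_app_last. }
  exists phi. split; [|split; [|split]].
  - intros x. exact (Hphi x 0).
  - intros x n. apply (proj2 (Hnext n (str x n ++ [x n]))). exact (Hphi x (S n)).
  - intros x x' E.
    assert (Hs : forall k, str x k = str x' k).
    { induction k as [|k IH]; [reflexivity|].
      change (next k (str x k ++ [x k]) = next k (str x' k ++ [x' k])).
      rewrite <- (Hbranch x k), <- (Hbranch x' k), E, IH. reflexivity. }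
    apply functional_extensionality; intro k.
    now rewrite <- (Hbranch x k), <- (Hbranch x' k), E, Hs.
  - intros x x' n Hn i Hi.
    assert (Hs : forall k, k <= n -> str x k = str x' k).
    { induction k as [|k IH]; intros Hk; [reflexivity|].
      change (next k (str x k ++ [x k]) = next k (str x' k ++ [x' k])).
      rewrite IH, Hn by lia. reflexivity. }
    pose proof (Hlen x n).
    rewrite (Hphi x n) by lia. rewrite (Hphi x' n) by (rewrite <- Hs; lia).
    now rewrite Hs.
Qed.

(** All output bits of [f] are decided on one common dense G_delta set, so [f] is continuous there;
    [root] confines the perfect set to a chosen cylinder. *)
Lemma borel_continuous_on_perfect (f : Cantor -> Cantor) (root : list bool) :
  (forall n, borel (fun x => f x n = true)) ->
  exists phi : Cantor -> Cantor,
    (forall x, prefix root (phi x)) /\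
    (forall x x', phi x = phi x' -> x = x') /\
    continuous_cantor (fun x => f (phi x)).
Proof.
  intros Hf.
  destruct (clopen_on_comeager_countable (fun n x => f x n = true)) as [D [HD Hdec]].
  { intros n. now apply borel_clopen_on_comeager. }
  destruct (perfect_set_in_comeager D root HD) as [phi [Hroot [HphiD [Hinj Hcont]]]].
  exists phi. split; [|split]; auto. intros x m.
  induction m as [|m [n Hn]].
  - exists 0. intros; lia.
  - destruct (Hdec m (phi x) (HphiD x)) as [n' Hn']. exists (n + n').
    intros x' Hx' i Hi. destruct (Nat.eq_dec i m) as [->|].
    + apply eq_true_iff_eq, Hn'; [apply HphiD|]. apply Hcont. intros j Hj. apply Hx'; lia.
    + apply Hn; [|lia]. intros j Hj. apply Hx'; lia.
Qed.

(** * The partial order *)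

Definition point_below_row (x y : Cantor) : Prop :=
  x 0 = false /\ y 0 = true /\
  exists i, forall n, x (S n) = y (S (S (pair_nat i n))).

(** The odd rows of [y] stay free for further points. A point in row [i] of [x] reappears in row
    [2 * i] of [y], which gives transitivity. *)
Definition even_rows_below (x y : Cantor) : Prop :=
  x 0 = true /\ x 1 = false /\ y 0 = true /\ y 1 = true /\
  forall i n, x (S (S (pair_nat i n))) = y (S (S (pair_nat (2 * i) n))).

(* A sequence [false, x] is the point [x]; [true, false, y] and [true, true, y] are
   the sequence of reals [y_i n = y <i, n>] at levels two and three.  A point lies
   below the sequences listing it, and a level two sequence lies below the level
   three sequences whose even rows it lists. *)
Definition row_le (x y : Cantor) : Prop :=
  x = y \/ point_below_row x y \/ even_rows_below x y.

(** * Borel complexity, local countability and height of the order *)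

Section SigmaAlgebra.
Variables (T : Type) (G : (T -> Prop) -> Prop).

Lemma sigma_or A B :
  sigma_gen G A -> sigma_gen G B -> sigma_gen G (fun x => A x \/ B x).
Proof.
  intros HA HB.
  apply sg_ext with (fun x => exists n, (match n with 0 => A | _ => B end) x).
  - apply (sg_union G (fun n => match n with 0 => A | _ => B end)). now intros [|n].
  - intros x. split.
    + intros [[|n] H]; auto.
    + intros [H|H]; [now exists 0|now exists 1].
Qed.

Lemma sigma_and A B :
  sigma_gen G A -> sigma_gen G B -> sigma_gen G (fun x => A x /\ B x).
Proof.
  intros HA HB. apply sg_ext with (fun x => ~ (~ A x \/ ~ B x)).
  - apply sg_compl, sigma_or; now apply sg_compl.
  - intros x. destruct (classic (A x)), (classic (B x)); tauto.
Qed.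

Lemma sigma_all (A : nat -> T -> Prop) :
  (forall n, sigma_gen G (A n)) -> sigma_gen G (fun x => forall n, A n x).
Proof.
  intros HA. apply sg_ext with (fun x => ~ exists n, ~ A n x).
  - apply sg_compl, (sg_union G (fun n x => ~ A n x)). intros n. now apply sg_compl.
  - intros x. split.
    + intros H n. apply NNPP. intros Hn. apply H. eauto.
    + intros H [n Hn]. auto.
Qed.

End SigmaAlgebra.

Lemma borel2_fst n b : borel2 (fun p => fst p n = b).
Proof. apply sg_gen. exists n, b. left. reflexivity. Qed.

Lemma borel2_snd n b : borel2 (fun p => snd p n = b).
Proof. apply sg_gen. exists n, b. right. reflexivity. Qed.

Lemma borel2_eq n m : borel2 (fun p => fst p n = snd p m).
Proof.
  apply sg_ext with (fun p => (fst p n = true /\ snd p m = true) \/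
                              (fst p n = false /\ snd p m = false)).
  - apply sigma_or; apply sigma_and; (apply borel2_fst || apply borel2_snd).
  - intros [a b]; simpl; destruct (a n), (b m); intuition congruence.
Qed.

Lemma row_le_borel : borel_rel row_le.
Proof.
  apply sigma_or; [|apply sigma_or].
  - apply sg_ext with (fun p => forall n, fst p n = snd p n).
    + apply (sigma_all _ _ (fun n p => fst p n = snd p n)). intros n. apply borel2_eq.
    + intros [a b]; simpl; split; [apply functional_extensionality|now intros ->].
  - apply sigma_and; [apply borel2_fst|]. apply sigma_and; [apply borel2_snd|].
    apply (sg_union _ (fun i p => forall n, fst p (S n) = snd p (S (S (pair_nat i n))))).
    intros i. apply (sigma_all _ _ (fun n p => fst p (S n) = snd p (S (S (pair_nat i n))))).
    intros n. apply borel2_eq.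
  - apply sigma_and; [apply borel2_fst|]. apply sigma_and; [apply borel2_fst|].
    apply sigma_and; [apply borel2_snd|]. apply sigma_and; [apply borel2_snd|].
    apply (sigma_all _ _ (fun i p => forall n,
      fst p (S (S (pair_nat i n))) = snd p (S (S (pair_nat (2 * i) n))))). intros i.
    apply (sigma_all _ _ (fun n p =>
      fst p (S (S (pair_nat i n))) = snd p (S (S (pair_nat (2 * i) n))))). intros n.
    apply borel2_eq.
Qed.

Definition rank (x : Cantor) : nat := if x 0 then if x 1 then 3 else 2 else 1.

Lemma row_le_rank x y : row_le x y -> x = y \/ rank x < rank y.
Proof.
  intros [->|[(Hx & Hy & _)|(Hx & Hx1 & Hy & Hy1 & _)]]; [now left|right|right];
    unfold rank; rewrite Hx, Hy.
  - destruct (y 1); lia.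
  - rewrite Hx1, Hy1; lia.
Qed.

Lemma row_le_partial_order : partial_order_on (fun _ => True) row_le.
Proof.
  split; [|split; [|split]].
  - auto.
  - now left.
  - intros x y Hxy Hyx. apply row_le_rank in Hxy, Hyx.
    destruct Hxy, Hyx; auto. lia.
  - intros x y w [->|Hxy] [->|Hyw]; [now left|now right|now right|].
    right. destruct Hxy as [(Hx & Hy & i & Hi)|(Hx & Hx1 & Hy & Hy1 & Hxy)],
      Hyw as [(Hy' & Hw & j & Hj)|(Hy' & Hy1' & Hw & Hw1 & Hyw)]; try congruence.
    left. split; [|split]; auto. exists (2 * i). intros n. now rewrite Hi, Hyw.
Qed.

Lemma row_le_locally_countable : locally_countable (fun _ => True) row_le.
Proof.
  intros y _.
  (* The only possible level two predecessor is spelled out by the even rows of [y] and gets number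
     0; the point in row [i] gets number [S i]. *)
  exists (fun i => match i with
    | 0 => fun k => match k with 0 => true | 1 => false
                    | S (S k) => y (S (S (pair_nat (2 * pfst k) (psnd k)))) end
    | S i => fun k => match k with 0 => false | S n => y (S (S (pair_nat i n))) end end).
  intros x [[E|[(Hx & _ & i & Hi)|(Hx & Hx1 & _ & _ & H)]] Hne]; [congruence| |].
  - exists (S i). apply functional_extensionality; intros [|n]; auto.
  - exists 0. apply functional_extensionality; intros [|[|k]]; auto.
    rewrite <- H. now rewrite pair_eta.
Qed.

Lemma row_le_height : has_height (fun _ => True) row_le 3.
Proof.
  split.
  - set (c := fun j k : nat => match k with
                  | 0 => 1 <=? j | 1 => 2 <=? j | _ => false end).
    exists c. split; auto. intros [|[|i]] Hi; [| |lia]; split.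
    + right; left. repeat split; auto. exists 0. now intros [|n].
    + intros E. apply (f_equal (fun g => g 0)) in E. discriminate.
    + right; right. repeat split; auto.
    + intros E. apply (f_equal (fun g => g 1)) in E. discriminate.
  - intros k c [_ Hc].
    assert (H : forall i, i < k -> i < rank (c i)).
    { induction i as [|i IH]; intros Hi.
      - unfold rank. destruct (c 0 0), (c 0 1); lia.
      - destruct (Hc i Hi) as [Hle Hne]. apply row_le_rank in Hle.
        destruct Hle as [E|Hlt]; [contradiction|]. specialize (IH ltac:(lia)). lia. }
    destruct k as [|k]; [lia|]. specialize (H k ltac:(lia)).
    unfold rank in H. destruct (c k 0), (c k 1); lia.
Qed.

(** Binary expansions enumerate the eventually zero sequences, so [Nat.testbit] can list the dense
    set as the rows of one element. *)
Lemma zeros_testbit s : exists i, Nat.testbit i = zeros s.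
Proof.
  induction s as [|b s [i Hi]].
  - exists 0. apply functional_extensionality; intro n. rewrite Nat.bits_0.
    symmetry; apply zeros_beyond; simpl; lia.
  - exists (2 * i + Nat.b2n b). apply functional_extensionality; intros [|n].
    + apply Nat.testbit_0_r.
    + rewrite Nat.testbit_succ_r, Hi. reflexivity.
Qed.

Theorem theorem1p7 :
  exists (P : Cantor -> Prop) (le : Cantor -> Cantor -> Prop),
    borel_partial_order P le /\
    locally_countable P le /\
    has_height P le 3 /\
    ~ (exists f : Cantor -> Cantor, borel_embedding_into_turing P le f).
Proof.
  exists (fun _ => True), row_le.
  split; [split; [|split; [exact row_le_borel|exact row_le_partial_order]]|].
  { apply sg_ext with (fun x => x 0 = true \/ ~ x 0 = true).
    - apply sigma_or; [|apply sg_compl]; apply sg_gen; exists 0, true; reflexivity.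
    - intros x. split; auto. intros _. apply classic. }
  split; [exact row_le_locally_countable|]. split; [exact row_le_height|].
  intros [f [Hmeas Hemb]].
  (* Equal images reduce to each other, reflexivity at [f x] being inherited from the order;
     antisymmetry of the order concludes. *)
  assert (f_inj : forall x y, f x = f y -> x = y).
  { intros x y E.
    assert (Hrefl : turing_le (f x) (f x)) by (apply Hemb; [exact I|exact I|now left]).
    apply row_le_partial_order; apply Hemb; auto.
    - rewrite <- E; exact Hrefl.
    - rewrite <- E; exact Hrefl. }
  (* The first [false] makes every [phi x] a point; the second keeps the perfect set away from the
     point [u] below, whose bit 1 is [true]. *)
  destruct (borel_continuous_on_perfect f [false; false]) as [phi [Hroot [Hinj Hcont]]].
  { intros n. apply sg_ext with (fun x => True /\ f x n = true); [|tauto].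
    apply (Hmeas (fun y => y n = true)). apply sg_gen. now exists n, true. }
  assert (Hphi0 : forall x, phi x 0 = false) by (intros x; apply (Hroot x 0); simpl; lia).
  assert (Hphi1 : forall x, phi x 1 = false) by (intros x; apply (Hroot x 1); simpl; lia).
  (* Bit 0 of a point is its level tag and is not stored in the row, hence [S (psnd k)]; [b]
     separates levels two and three. *)
  set (rows := fun (b : bool) (p : nat -> Cantor) (k : nat) => match k with
     | 0 => true | 1 => b | S (S k) => phi (p (pfst k)) (S (psnd k)) end).
  assert (Hrows : forall b p i, turing_le (f (phi (p i))) (f (rows b p))).
  { intros b p i. apply Hemb; auto. right; left. split; [apply Hphi0|]. split; [reflexivity|].
    exists i. intros n. simpl. now rewrite pfst_pair, psnd_pair. }
  set (z := rows false Nat.testbit).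
  set (u := fun n => n =? 1).
  destruct (coding_four_reals (fun x => f (phi x)) Hcont) with (z := f z) (x := f u)
    as [xA [xB Hcode]].
  { intros x x' E. now apply Hinj, f_inj. }
  { intros s. destruct (zeros_testbit s) as [i <-]. exact (Hrows false Nat.testbit i). }
  (* Even rows repeat those of [z]; rows 1, 3, 5 and 7 hold the four coding points, and later odd
     rows repeat the last of them. *)
  set (p := fun i => if Nat.even i then Nat.testbit (Nat.div2 i) else
     match i with 1 => xA true | 3 => xA false | 5 => xB true | _ => xB false end).
  set (w := rows true p).
  assert (Hu : row_le u w).
  { apply Hemb; auto. apply Hcode.
    - apply Hemb; auto. right; right. repeat split; auto. intros i n.
      unfold z, w, rows. rewrite !pfst_pair, !psnd_pair. unfold p.
      rewrite Nat.even_mul, Nat.div2_double. reflexivity.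
    - intros [|]; [exact (Hrows true p 1)|exact (Hrows true p 3)].
    - intros [|]; [exact (Hrows true p 5)|exact (Hrows true p 7)]. }
  destruct Hu as [E|[(_ & _ & i & Hi)|(Hu0 & _)]].
  - apply (f_equal (fun g => g 0)) in E. discriminate.
  (* Entry 0 of a row of [w] is bit 1 of a value of [phi], hence [false], whereas [u 1] is
     [true]. *)
  - specialize (Hi 0). unfold w, rows in Hi. rewrite psnd_pair, Hphi1 in Hi. discriminate.
  - discriminate.
Qed.
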